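(* Let $m\in\mathbb{N}$. For every $\delta>0$ there exists $N\in\mathbb{N}$ such that every $N$-partitioned hypergraph $H$ with density at least $4/27+\delta$ embeds the tight $3$-uniform cycle $C_{3m+2}^{(3)}$.
   Context: An $n$-partitioned hypergraph $H$ is a finite $3$-uniform hypergraph whose vertex set is partitioned into nonempty sets $V_{ij}$, $1\le i<j\le n$, such that every edge has, for some $1\le i<j<k\le n$, exactly one vertex in each of $V_{ij}$, $V_{ik}$, $V_{jk}$; the set of such edges is the $(i,j,k)$-triad, its density is its number of edges divided by $|V_{ij}||V_{ik}||V_{jk}|$, and the density of $H$ is the minimum density of a triad. For convenience write $V_{ji}=V_{ij}$. An $N$-partitioned hypergraph $H$ embeds a $3$-uniform hypergraph $H_0$ with vertices $1,\ldots,n$ if there are distinct $a_1,\ldots,a_n\in[N]$ and vertices $v_{ij}\in V_{a_ia_j}$ for $1\le i<j\le n$ such that whenever $\{i,j,k\}$, $i<j<k$, is an edge of $H_0$, the set $\{v_{ij},v_{ik},v_{jk}\}$ is an edge of $H$. The tight cycle $C_\ell^{(3)}$ has vertices $1,\ldots,\ell$ and edges $\{i,i+1,i+2\}$ with indices modulo $\ell$. *)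

(* Defs.v *)
From mathcomp Require Import all_boot all_order all_algebra.
Set Implicit Arguments. Unset Strict Implicit. Unset Printing Implicit Defensive.
Import Order.TTheory GRing.Theory Num.Theory.

(* An N-partitioned hypergraph: a finite vertex type V, a labelling
   [p : V -> 'I_N * 'I_N] assigning each vertex its part V_{ij} (with i < j),
   and an edge set E of 3-element vertex sets. *)

(* v lies in V_{xy} (with the convention V_{yx} = V_{xy}). *)
Definition inpart (N : nat) (V : finType) (p : V -> 'I_N * 'I_N) (x y : 'I_N) (v : V) : bool :=
  (p v == (x, y)) || (p v == (y, x)).

Definition part (N : nat) (V : finType) (p : V -> 'I_N * 'I_N) (i j : 'I_N) : {set V} :=
  [set v | inpart p i j v].

Definition in_triad (N : nat) (V : finType) (p : V -> 'I_N * 'I_N) (i j k : 'I_N) (e : {set V}) : bool :=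
  [&& #|e :&: part p i j| == 1, #|e :&: part p i k| == 1, #|e :&: part p j k| == 1
    & #|e| == 3].

Definition partitioned_hypergraph (N : nat) (V : finType) (p : V -> 'I_N * 'I_N)
  (E : {set {set V}}) : Prop :=
  [/\ (forall v, ((p v).1 < (p v).2)%N),
      (forall i j : 'I_N, (i < j)%N -> exists v, p v = (i, j)) &
      (forall e, e \in E -> exists i j k : 'I_N, [&& (i < j)%N, (j < k)%N & in_triad p i j k e])].

Definition triad (N : nat) (V : finType) (p : V -> 'I_N * 'I_N) (E : {set {set V}}) (i j k : 'I_N)
  : {set {set V}} := [set e in E | in_triad p i j k e].

Definition triad_density (R : realFieldType) (N : nat) (V : finType) (p : V -> 'I_N * 'I_N)
  (E : {set {set V}}) (i j k : 'I_N) : R :=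
  (#|triad p E i j k|%:R / (#|part p i j| * #|part p i k| * #|part p j k|)%:R)%R.

Definition density_at_least (R : realFieldType) (N : nat) (V : finType) (p : V -> 'I_N * 'I_N)
  (E : {set {set V}}) (d : R) : Prop :=
  forall i j k : 'I_N, (i < j)%N -> (j < k)%N -> (d <= triad_density R p E i j k)%R.

Definition embeds (N : nat) (V : finType) (p : V -> 'I_N * 'I_N) (E : {set {set V}})
  (n : nat) (H0 : {set {set 'I_n}}) : Prop :=
  exists (a : 'I_n -> 'I_N) (v : 'I_n -> 'I_n -> V),
    injective a /\
    (forall i j : 'I_n, (i < j)%N -> inpart p (a i) (a j) (v i j)) /\
    (forall i j k : 'I_n, (i < j)%N -> (j < k)%N -> [set i; j; k] \in H0 ->
        [set v i j; v i k; v j k] \in E).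

Definition addmod (l : nat) (i : 'I_l) (k : nat) : 'I_l :=
  Ordinal (ltn_pmod (i + k) (leq_ltn_trans (leq0n i) (ltn_ord i))).

Definition tight_cycle (l : nat) : {set {set 'I_l}} :=
  [set [set i; addmod i 1; addmod i 2] | i : 'I_l].

(* Main.v *)
Require Import Defs.
From mathcomp Require Import all_boot all_order all_algebra.
From mathcomp Require Import reals.
From mathcomp Require Import boolp ring lra zify.
Import Order.TTheory GRing.Theory Num.Theory.
Set Implicit Arguments. Unset Strict Implicit. Unset Printing Implicit Defensive.

(* The host is reduced to a finite palette: a set P of triples of K colours, used in the
   same way on every triad of a large index subset.  Choose K vertices (labels) in each V_ij
   one at a time, each time moving mass 1/K of the uniform measure of V_ij onto the new label.
   The first-order change of the density of a triad is a sum of three terms, each depending on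
   a single label; averaging and Ramsey's theorem give labels for which this sum is almost
   nonnegative on all triads of a large index subset, so a step costs only O(1/K^2) and the
   whole process O(1/K).  A last application of Ramsey's theorem makes the patterns of the
   triads equal, giving a palette of density above 4/27.

   A palette of density above 4/27 colours C_5.  Otherwise move weight between colours lying in
   no common triple until any two colours of the support do (Motzkin-Straus).  If (a,b,c) and
   (b,a,c), or their mirror images, lie in P, then every triple contains c exactly once, and at
   most two of the six orders of a, b, c are in P, so the density is at most y(1-y)^2 <= 4/27
   with y the weight of c.  If not, three colours carry at most one ordered triple and four
   colours never carry four, so the density is at most 1/8.

   Finally C_{3m+2} maps homomorphically to C_5, and a palette colouring C_5 also colours
   everything that maps to C_5. *)

(** * Palettes and refutation certificates *)

(* A palette [P x y z] lists the colours of the pairs ij, ik, jk allowed for i < j < k; here the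
   three vertices u, v, w come with arbitrary ranks. *)
Definition sorted_triple (A : Type) (P : A -> A -> A -> bool) (ru rv rw : nat)
    (uv uw vw : A) : bool :=
  if ru < rv then
    if rv < rw then P uv uw vw else if ru < rw then P uw uv vw else P uw vw uv
  else if ru < rw then P uv vw uw
  else if rv < rw then P vw uv uw else P vw uw uv.

(** Here [r] orders the five vertices, [e i] colours the pair of i and i+1, and [z i] the pair of i
    and i+2. A pair at distance two lies in a single edge of the cycle, so the values of [z] can be
    chosen independently of one another. *)
Definition colors_C5 (A : Type) (P : A -> A -> A -> bool) : Prop :=
  exists (r : 'I_5 -> 'I_5) (e z : 'I_5 -> A), injective r /\
    forall i, sorted_triple P (r i) (r (addmod i 1)) (r (addmod i 2))
                (e i) (z i) (e (addmod i 1)).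

Definition ordered (A : Type) (P : A -> A -> A -> bool) (x y z : A) : bool :=
  [|| P x y z, P x z y, P y x z, P z x y, P y z x | P z y x].

(* A refutation derives a colouring of C_5 from triples of P whose entries are colour variables
   (numbers).  [Walk] exhibits a closed walk: ranks of the five vertices and colours of the five
   edges.  [Cover x y] introduces a fresh variable forming a triple with the distinct colours x, y
   in one of six orders, [Orient x y z] branches over the orders of a triple known to be ordered,
   and [Identify x y] branches over x = y. *)
Inductive refutation :=
| Walk (r0 r1 r2 r3 r4 e0 e1 e2 e3 e4 : nat)
| Cover (x y : nat) (c1 c2 c3 c4 c5 c6 : refutation)
| Orient (x y z : nat) (c1 c2 c3 c4 c5 c6 : refutation)
| Identify (x y : nat) (ceq cneq : refutation).

Definition triples := seq (nat * nat * nat).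

(** The colour of the pair at distance two is not recorded in a walk: it only has to exist, and the
    three entries of the triple used are the only candidates. *)
Definition corner (s : triples) (ru rv rw a c : nat) : bool :=
  has (fun t => let in_t x y z := (x, y, z) == t in
    [|| sorted_triple in_t ru rv rw a t.1.1 c, sorted_triple in_t ru rv rw a t.1.2 c
      | sorted_triple in_t ru rv rw a t.2 c]) s.

Definition rename (x y : nat) (t : nat * nat * nat) : nat * nat * nat :=
  let f v := if v == y then x else v in (f t.1.1, f t.1.2, f t.2).

Definition below (n : nat) (t : nat * nat * nat) : bool :=
  [&& t.1.1 < n, t.1.2 < n & t.2 < n].

(** The state of a branch: [s] holds triples known to lie in the palette, [os] triples lying there
    in some order, [ne] pairs of distinct colours. At a [Cover] all variables in use are below [n],
    so [n] itself serves as the fresh one. The flag [cov] tells whether [Cover] is allowed. *)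
Fixpoint check (cov : bool) (c : refutation) (s os : triples) (ne : seq (nat * nat)) (n : nat) :=
  match c with
  | Walk r0 r1 r2 r3 r4 e0 e1 e2 e3 e4 =>
    [&& uniq [:: r0; r1; r2; r3; r4] && all (ltn^~ 5) [:: r0; r1; r2; r3; r4],
        corner s r0 r1 r2 e0 e1, corner s r1 r2 r3 e1 e2,
        corner s r2 r3 r4 e2 e3, corner s r3 r4 r0 e3 e4 & corner s r4 r0 r1 e4 e0]
  | Cover x y c1 c2 c3 c4 c5 c6 =>
    let go o c' := check cov c' (o :: s) os ne n.+1 in
    [&& cov, ((x, y) \in ne) || ((y, x) \in ne), (x < n) && (y < n),
        all (below n) s, all (below n) os, all (fun p => (p.1 < n) && (p.2 < n)) ne,
        go (x, y, n) c1, go (x, n, y) c2, go (y, x, n) c3, go (n, x, y) c4,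
        go (y, n, x) c5 & go (n, y, x) c6]
  | Orient x y z c1 c2 c3 c4 c5 c6 =>
    let go o c' := check cov c' (o :: s) os ne n in
    [&& (x, y, z) \in os,
        go (x, y, z) c1, go (x, z, y) c2, go (y, x, z) c3, go (z, x, y) c4,
        go (y, z, x) c5 & go (z, y, x) c6]
  | Identify x y ceq cneq =>
    let f v := if v == y then x else v in
    check cov ceq (map (rename x y) s) (map (rename x y) os)
      [seq (f p.1, f p.2) | p <- ne] n
    && check cov cneq s os ((x, y) :: ne) n
  end.

Section Soundness.
Variables (A : eqType) (P : A -> A -> A -> bool) (D : {pred A}) (cov : bool).
Hypothesis noC5 : ~ colors_C5 P.
Hypothesis PD : forall x y z, P x y z -> [&& x \in D, y \in D & z \in D].
Hypothesis covP : cov ->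
  forall x y, x \in D -> y \in D -> x != y -> exists z, ordered P x y z.

Definition holds (f : nat -> A) (t : nat * nat * nat) : bool := P (f t.1.1) (f t.1.2) (f t.2).
Definition holds_ord (f : nat -> A) (t : nat * nat * nat) : bool :=
  ordered P (f t.1.1) (f t.1.2) (f t.2).

Lemma corner_sound f s ru rv rw a c : all (holds f) s -> corner s ru rv rw a c ->
  exists b, sorted_triple P ru rv rw (f a) b (f c).
Proof.
move=> hs /hasP[[[x y] z] ts hc].
have Pt : P (f x) (f y) (f z) by have /allP/(_ _ ts) := hs.
have {hc}[b hb] : exists b, sorted_triple (fun x' y' z' => (x', y', z') == (x, y, z)) ru rv rw a b c.
  by move: hc => /or3P[] h; [exists x | exists y | exists z].
exists (f b); move: hb; rewrite /sorted_triple.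
by do ![case: ifP => _] => /eqP[-> -> ->].
Qed.

Lemma walk_colors_C5 f s r0 r1 r2 r3 r4 e0 e1 e2 e3 e4 : all (holds f) s ->
  [&& uniq [:: r0; r1; r2; r3; r4] && all (ltn^~ 5) [:: r0; r1; r2; r3; r4],
      corner s r0 r1 r2 e0 e1, corner s r1 r2 r3 e1 e2,
      corner s r2 r3 r4 e2 e3, corner s r3 r4 r0 e3 e4 & corner s r4 r0 r1 e4 e0] ->
  colors_C5 P.
Proof.
move=> hs /and5P[/andP[rU r5] h0 h1 h2 /andP[h3 h4]].
have [[b0 H0] [b1 H1] [b2 H2]] :=
  And3 (corner_sound hs h0) (corner_sound hs h1) (corner_sound hs h2).
have [[b3 H3] [b4 H4]] := conj (corner_sound hs h3) (corner_sound hs h4).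
pose rs := [:: r0; r1; r2; r3; r4].
have rlt (i : 'I_5) : nth 0 rs i < 5 by apply: (allP r5); rewrite mem_nth.
exists (fun i => Ordinal (rlt i)).
exists (fun i => f (nth 0 [:: e0; e1; e2; e3; e4] i)).
exists (fun i => nth b0 [:: b0; b1; b2; b3; b4] i); split.
  by move=> i j [/eqP]; rewrite nth_uniq // => /eqP/val_inj.
by case=> [[|[|[|[|[|]]]]] ilt].
Qed.

(** A valuation [f] of the variables singles out one branch at every node, and that branch ends in a
    walk, contradicting [noC5]. At a [Cover] the valuation is changed at the fresh variable only;
    renaming y to x in the equality branch changes no value. *)
Lemma check_sound c s os ne n (f : nat -> A) : (forall v, f v \in D) ->
  all (holds f) s -> all (holds_ord f) os -> all (fun p => f p.1 != f p.2) ne ->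
  ~~ check cov c s os ne n.
Proof.
elim: c s os ne n f => [r0 r1 r2 r3 r4 e0 e1 e2 e3 e4|x y c1 I1 c2 I2 c3 I3 c4 I4 c5 I5 c6 I6
   |x y z c1 I1 c2 I2 c3 I3 c4 I4 c5 I5 c6 I6|x y ce Ie cn In] s os ne n f fD hs ho hn /=.
- by apply/negP => /(walk_colors_C5 hs).
- apply/negP => /and5P[/covP covP' xy /andP[xn yn] sn /and5P[on nn k1 k2 /and4P[k3 k4 k5 k6]]].
  have fxy : f x != f y.
    by case/orP: xy => /(allP hn) //=; rewrite eq_sym.
  have [z oz] := covP' _ _ (fD x) (fD y) fxy.
  have zD : z \in D.
    by case/or4P: oz => [/PD|/PD|/PD|/or3P[/PD|/PD|/PD]] /and3P[].
  pose g v := if v == n then z else f v.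
  have gf v : v < n -> g v = f v by move=> vn; rewrite /g ltn_eqF.
  have gn : g n = z by rewrite /g eqxx.
  have gD v : g v \in D by rewrite /g; case: ifP.
  have hs' : all (holds g) s.
    apply/allP => t ts; have /and3P[t1 t2 t3] := allP sn _ ts.
    by rewrite /holds !gf //; apply: (allP hs).
  have ho' : all (holds_ord g) os.
    apply/allP => t ts; have /and3P[t1 t2 t3] := allP on _ ts.
    by rewrite /holds_ord !gf //; apply: (allP ho).
  have hn' : all (fun p => g p.1 != g p.2) ne.
    apply/allP => t ts; have /andP[t1 t2] := allP nn _ ts.
    by rewrite !gf //; apply: (allP hn).
  have cons_s o : holds g o -> all (holds g) (o :: s) by rewrite /= => ->.
  case/or4P: oz => [h|h|h|/or3P[h|h|h]].
  + by apply/negP: k1; apply: (I1 _ _ _ _ g) => //; apply: cons_s; rewrite /holds /= gn !gf.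
  + by apply/negP: k2; apply: (I2 _ _ _ _ g) => //; apply: cons_s; rewrite /holds /= gn !gf.
  + by apply/negP: k3; apply: (I3 _ _ _ _ g) => //; apply: cons_s; rewrite /holds /= gn !gf.
  + by apply/negP: k4; apply: (I4 _ _ _ _ g) => //; apply: cons_s; rewrite /holds /= gn !gf.
  + by apply/negP: k5; apply: (I5 _ _ _ _ g) => //; apply: cons_s; rewrite /holds /= gn !gf.
  + by apply/negP: k6; apply: (I6 _ _ _ _ g) => //; apply: cons_s; rewrite /holds /= gn !gf.
- apply/negP => /and5P[xyz k1 k2 k3 /and3P[k4 k5 k6]].
  have cons_s o : holds f o -> all (holds f) (o :: s) by rewrite /= => ->.
  have := allP ho _ xyz; rewrite /holds_ord /ordered /= => /or4P[h|h|h|/or3P[h|h|h]].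
  + by apply/negP: k1; apply: (I1 _ _ _ _ f) => //; apply: cons_s.
  + by apply/negP: k2; apply: (I2 _ _ _ _ f) => //; apply: cons_s.
  + by apply/negP: k3; apply: (I3 _ _ _ _ f) => //; apply: cons_s.
  + by apply/negP: k4; apply: (I4 _ _ _ _ f) => //; apply: cons_s.
  + by apply/negP: k5; apply: (I5 _ _ _ _ f) => //; apply: cons_s.
  + by apply/negP: k6; apply: (I6 _ _ _ _ f) => //; apply: cons_s.
- rewrite negb_and; case: (altP (f x =P f y)) => fxy.
  + have fr v : f (if v == y then x else v) = f v by case: eqP => // ->.
    apply/orP; left; apply: (Ie _ _ _ _ f) => //.
    * by rewrite all_map; apply: sub_all hs => t; rewrite /holds /= !fr.
    * by rewrite all_map; apply: sub_all ho => t; rewrite /holds_ord /= !fr.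
    * by rewrite all_map; apply: sub_all hn => t /=; rewrite !fr.
  + by apply/orP; right; apply: (In _ _ _ _ f) => //=; rewrite fxy.
Qed.
End Soundness.

(* Found by computer search: variables 0, 1, 2 are a, b, c with (a,b,c) and (b,a,c) in P, and
   3, 4, 5 form a triple of P avoiding c. *)
Definition avoid_refutation : refutation :=
  Cover 2 3 (Identify 0 3 (Walk 0 2 1 3 4 1 2 0 2 0) (Cover 0 3 (Walk 0 2 1 4 3 1 2 3 7 0)
  (Walk 0 1 3 4 2 1 2 6 3 0) (Walk 0 2 1 3 4 1 2 3 7 0) (Walk 0 1 4 3 2 7 3 6 2 0)
  (Identify 0 6 (Walk 0 1 2 3 4 1 2 0 2 0) (Cover 0 6 (Walk 0 1 2 4 3 1 2 6 8 0) (Walk 0 2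
  1 4 3 1 2 3 6 0) (Walk 0 1 2 3 4 1 2 6 8 0) (Walk 0 2 4 1 3 8 6 3 2 0) (Identify 2 7
  (Identify 5 6 (Walk 0 1 2 3 4 3 0 2 5 4) (Cover 5 6 (Walk 0 1 3 4 2 3 5 9 6 2) (Walk 0 1
  2 3 4 3 5 6 0 2) (Walk 0 1 3 4 2 2 6 9 5 3) (Walk 0 3 2 1 4 3 6 9 5 4) (Cover 2 4 (Walk
  0 1 2 3 4 3 0 2 10 4) (Walk 0 2 3 1 4 2 6 3 4 10) (Walk 0 1 2 4 3 3 0 2 10 4) (Walk 0 1
  4 3 2 10 4 5 6 2) (Walk 0 3 2 1 4 4 5 3 2 10) (Walk 0 1 2 3 4 10 2 6 5 4)) (Walk 0 3 1 2
  4 3 6 9 5 4))) (Cover 2 7 (Walk 0 1 2 3 4 3 0 2 9 7) (Walk 0 2 3 1 4 2 6 3 7 9) (Walk 0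
  1 2 4 3 3 0 2 9 7) (Walk 0 1 4 3 2 9 7 0 6 2) (Walk 0 2 1 3 4 7 0 1 2 9) (Walk 0 1 2 3 4
  9 2 6 0 7))) (Walk 0 3 1 2 4 3 6 8 0 7))) (Walk 0 1 2 3 4 7 0 2 6 3))) (Identify 0 6
  (Walk 0 2 1 3 4 1 2 0 2 0) (Cover 0 6 (Walk 0 2 1 4 3 1 2 6 7 0) (Walk 0 1 3 4 2 1 2 3 6
  0) (Walk 0 2 1 3 4 1 2 6 7 0) (Walk 0 1 4 3 2 7 6 3 2 0) (Identify 0 3 (Walk 0 1 2 3 4 1
  2 0 2 0) (Cover 0 3 (Walk 0 1 2 4 3 1 2 3 8 0) (Walk 0 2 1 4 3 1 2 6 3 0) (Walk 0 1 2 3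
  4 1 2 3 8 0) (Walk 0 2 4 1 3 8 3 6 2 0) (Identify 2 7 (Cover 2 4 (Walk 0 1 2 3 4 3 0 2 9
  4) (Walk 0 3 2 1 4 2 0 3 4 9) (Walk 0 1 2 4 3 3 0 2 9 4) (Walk 0 1 4 3 2 9 4 5 3 2)
  (Identify 0 4 (Walk 0 1 2 3 4 1 2 3 5 0) (Cover 0 4 (Walk 0 1 2 3 4 0 2 3 5 4) (Walk 0 2
  4 1 3 0 2 9 4 10) (Walk 0 2 3 1 4 3 5 4 0 8) (Walk 0 2 1 4 3 0 4 9 2 1) (Walk 0 1 2 3 4
  4 2 3 0 10) (Walk 0 2 1 3 4 4 0 1 2 9))) (Walk 0 1 2 3 4 9 2 3 5 4)) (Cover 2 7 (Walk 0
  1 2 3 4 6 0 2 9 7) (Walk 0 2 3 1 4 2 3 6 7 9) (Walk 0 1 2 4 3 6 0 2 9 7) (Walk 0 1 4 3 2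
  9 7 0 3 2) (Walk 0 2 1 3 4 7 0 1 2 9) (Walk 0 1 2 3 4 9 2 3 0 7))) (Walk 0 3 1 2 4 6 3 8
  0 7))) (Walk 0 1 2 3 4 7 0 2 3 6))) (Identify 0 3 (Walk 0 2 3 1 4 1 2 0 2 0) (Cover 0 3
  (Walk 0 2 3 1 4 0 7 3 2 1) (Walk 0 1 3 4 2 0 3 6 2 1) (Walk 0 3 1 2 4 1 2 3 7 0) (Walk 0
  1 3 4 2 7 3 6 2 0) (Identify 1 3 (Walk 0 2 3 1 4 1 2 1 2 0) (Cover 1 3 (Walk 0 2 3 1 4 1
  8 3 2 0) (Walk 0 1 2 3 4 1 3 0 2 0) (Walk 0 2 3 1 4 3 8 1 0 7) (Walk 0 1 2 3 4 8 3 0 2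
  1) (Cover 2 4 (Walk 0 1 2 3 4 3 0 2 9 4) (Walk 0 3 2 1 4 2 6 3 4 9) (Walk 0 1 2 4 3 3 0
  2 9 4) (Identify 0 4 (Walk 0 2 3 1 4 3 5 0 1 8) (Cover 0 4 (Walk 0 2 4 1 3 3 5 4 0 7)
  (Walk 0 3 1 2 4 0 2 9 4 10) (Walk 0 2 3 1 4 3 5 4 0 7) (Walk 0 3 1 2 4 1 2 9 4 0) (Walk
  0 1 3 4 2 3 0 2 0 4) (Identify 1 9 (Walk 0 1 4 2 3 3 0 2 1 8) (Cover 1 9 (Walk 0 2 3 1 4
  1 11 9 2 0) (Walk 0 1 2 3 4 3 1 9 4 2) (Walk 0 3 1 2 4 0 2 9 11 1) (Walk 0 1 3 4 2 11 9
  4 2 1) (Walk 0 1 3 2 4 9 4 0 1 11) (Walk 0 1 2 4 3 11 1 2 4 9))))) (Walk 0 3 2 1 4 4 5 3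
  2 9) (Identify 0 4 (Walk 0 2 3 1 4 3 5 0 1 8) (Cover 0 4 (Walk 0 2 4 1 3 3 5 4 0 7)
  (Walk 0 3 2 1 4 0 2 9 4 10) (Walk 0 2 3 1 4 3 5 4 0 7) (Walk 0 3 1 2 4 0 4 9 2 1) (Walk
  0 1 3 4 2 3 0 2 0 4) (Walk 0 2 3 1 4 9 2 1 0 4)))) (Walk 0 1 2 4 3 8 1 2 6 3))) (Walk 0
  1 2 4 3 7 0 2 6 3))) (Identify 0 6 (Walk 0 2 3 1 4 1 2 0 2 0) (Cover 0 6 (Walk 0 2 3 1 4
  0 7 6 2 1) (Walk 0 1 3 4 2 0 6 3 2 1) (Walk 0 3 1 2 4 1 2 6 7 0) (Walk 0 1 3 4 2 7 6 3 2
  0) (Identify 1 6 (Walk 0 2 3 1 4 1 2 1 2 0) (Cover 1 6 (Walk 0 2 3 1 4 1 8 6 2 0) (Walk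
  0 1 2 3 4 1 6 0 2 0) (Walk 0 2 3 1 4 6 8 1 0 7) (Walk 0 1 2 3 4 8 6 0 2 1) (Identify 2 7
  (Identify 2 8 (Cover 2 5 (Walk 0 1 2 4 3 6 3 5 9 2) (Identify 0 3 (Walk 0 2 1 3 4 2 1 0
  5 9) (Cover 0 3 (Walk 0 2 1 3 4 2 0 3 5 9) (Walk 0 2 4 1 3 6 3 10 0 2) (Walk 0 2 4 1 3 3
  5 9 2 0) (Walk 0 2 3 1 4 6 3 0 1 2) (Walk 0 1 2 3 4 3 0 2 5 4) (Walk 0 1 3 2 4 6 3 0 1
  2))) (Walk 0 1 2 3 4 6 3 5 9 2) (Walk 0 2 4 1 3 9 5 4 3 2) (Identify 0 4 (Walk 0 2 1 4 3
  0 5 9 2 1) (Cover 0 4 (Walk 0 2 4 1 3 0 2 9 5 4) (Walk 0 1 3 2 4 0 2 3 4 10) (Walk 0 2 1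
  4 3 4 5 9 2 0) (Walk 0 1 3 2 4 1 2 3 4 0) (Walk 0 1 2 4 3 3 5 2 0 4) (Walk 0 2 4 1 3 6 0
  4 3 2))) (Identify 0 4 (Walk 0 3 1 2 4 0 5 9 2 1) (Cover 0 4 (Walk 0 3 2 1 4 0 2 9 5 4)
  (Walk 0 1 3 2 4 0 2 3 4 10) (Walk 0 3 1 2 4 4 5 9 2 0) (Walk 0 1 3 2 4 1 2 3 4 0) (Walk
  0 1 4 3 2 3 5 2 0 4) (Walk 0 2 4 1 3 6 0 4 3 2)))) (Cover 2 8 (Walk 0 1 2 3 4 6 0 2 9 8)
  (Walk 0 3 2 1 4 2 0 6 8 9) (Walk 0 1 2 4 3 6 0 2 9 8) (Walk 0 1 3 2 4 9 8 1 0 2) (Walk 0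
  2 1 3 4 8 1 0 2 9) (Walk 0 1 3 2 4 9 2 0 1 8))) (Cover 2 7 (Walk 0 1 2 3 4 6 0 2 9 7)
  (Walk 0 3 2 1 4 2 3 6 7 9) (Walk 0 1 2 4 3 6 0 2 9 7) (Identify 1 9 (Walk 0 1 4 2 3 6 0
  2 1 8) (Cover 1 9 (Walk 0 2 3 1 4 1 10 9 2 0) (Walk 0 1 2 3 4 6 1 9 7 2) (Walk 0 3 1 2 4
  0 2 9 10 1) (Walk 0 1 3 4 2 10 9 7 2 1) (Walk 0 1 3 2 4 9 7 0 1 10) (Walk 0 1 2 4 3 10 1
  2 7 9))) (Walk 0 2 1 3 4 7 0 1 2 9) (Walk 0 2 3 1 4 9 2 1 0 7))) (Walk 0 1 2 4 3 8 1 2 3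
  6))) (Walk 0 1 2 4 3 7 0 2 3 6))) (Identify 0 3 (Cover 2 5 (Walk 0 1 3 4 2 1 2 7 5 0)
  (Walk 0 2 1 4 3 1 2 7 5 0) (Walk 0 1 3 4 2 0 5 7 2 1) (Walk 0 3 1 2 4 0 2 7 5 4) (Walk 0
  2 4 1 3 0 2 7 5 4) (Walk 0 3 2 1 4 0 2 7 5 4)) (Cover 0 3 (Identify 2 7 (Cover 2 5 (Walk
  0 1 3 4 2 0 2 8 5 3) (Walk 0 2 1 4 3 0 2 8 5 3) (Walk 0 1 4 3 2 0 2 8 5 3) (Walk 0 3 1 2
  4 3 2 8 5 4) (Walk 0 2 4 1 3 3 2 8 5 4) (Walk 0 3 2 1 4 3 2 8 5 4)) (Cover 2 7 (Walk 0 1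
  3 4 2 1 2 8 7 0) (Walk 0 2 1 4 3 1 2 8 7 0) (Walk 0 1 3 4 2 0 7 8 2 1) (Walk 0 3 1 2 4 0
  2 8 7 3) (Walk 0 2 4 1 3 0 2 8 7 3) (Walk 0 3 1 2 4 3 7 8 2 6))) (Walk 0 2 4 1 3 0 2 6 3
  7) (Cover 2 5 (Walk 0 1 4 3 2 3 5 8 2 0) (Walk 0 2 4 1 3 3 5 8 2 0) (Walk 0 1 3 4 2 3 5
  8 2 0) (Identify 0 4 (Walk 0 3 1 2 4 1 2 8 5 0) (Cover 0 4 (Walk 0 3 1 2 4 0 2 8 5 4)
  (Walk 0 3 2 1 4 0 2 3 4 9) (Walk 0 3 2 1 4 4 5 8 2 0) (Walk 0 3 1 2 4 0 4 3 2 1) (Walk 0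
  3 2 1 4 4 5 3 0 9) (Walk 0 2 3 1 4 3 2 1 0 4))) (Walk 0 2 4 1 3 3 2 8 5 4) (Identify 0 4
  (Walk 0 3 1 2 4 0 5 8 2 1) (Cover 0 4 (Walk 0 3 2 1 4 0 2 8 5 4) (Walk 0 3 2 1 4 0 2 3 4
  9) (Walk 0 3 1 2 4 4 5 8 2 0) (Walk 0 3 1 2 4 0 4 3 2 1) (Walk 0 1 4 3 2 3 5 2 0 4)
  (Walk 0 2 3 1 4 3 2 1 0 4)))) (Walk 0 2 1 4 3 0 3 6 2 1) (Walk 0 2 3 1 4 3 2 1 0 7)
  (Walk 0 2 1 3 4 3 0 1 2 6))) (Cover 2 5 (Walk 0 1 3 4 2 6 2 7 5 3) (Identify 0 3 (Walk 0
  2 1 4 3 1 2 7 5 0) (Cover 0 3 (Walk 0 2 1 4 3 0 2 7 5 3) (Walk 0 3 2 1 4 0 2 6 3 8)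
  (Walk 0 2 4 1 3 3 5 7 2 0) (Walk 0 3 1 2 4 0 3 6 2 1) (Walk 0 1 2 3 4 3 0 2 5 4) (Walk 0
  2 3 1 4 6 2 1 0 3))) (Walk 0 1 4 3 2 6 2 7 5 3) (Walk 0 3 1 2 4 3 2 7 5 4) (Identify 0 4
  (Walk 0 2 1 4 3 0 5 7 2 1) (Cover 0 4 (Walk 0 2 4 1 3 0 2 7 5 4) (Walk 0 2 3 1 4 0 2 3 4
  8) (Walk 0 2 1 4 3 4 5 7 2 0) (Walk 0 2 3 1 4 1 2 3 4 0) (Walk 0 1 3 4 2 3 5 2 0 4)
  (Walk 0 3 2 1 4 3 2 1 0 4))) (Walk 0 3 2 1 4 3 2 7 5 4)).

(** Variables 0 to 3 are four colours with (0,1,2) in the palette in this order; the branching is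
    over the orders of the other three triples. *)
Definition tetrahedron_refutation : refutation :=
  Orient 0 1 3 (Orient 0 2 3 (Orient 1 2 3 (Walk 0 2 3 1 4 0 2 1 2 1) (Walk 0 2 3 1 4 0 2
  1 3 1) (Walk 0 2 4 1 3 0 2 1 2 1) (Walk 0 2 4 1 3 0 2 1 3 1) (Walk 0 1 4 2 3 0 2 3 2 1)
  (Walk 0 1 3 2 4 0 2 3 2 1)) (Orient 1 2 3 (Walk 0 2 3 1 4 0 2 1 2 1) (Walk 0 2 3 1 4 0 2
  1 3 1) (Walk 0 2 4 1 3 0 2 1 2 1) (Walk 0 2 4 1 3 0 2 1 3 1) (Walk 0 1 3 2 4 0 3 2 3 1)
  (Walk 0 1 4 2 3 0 3 2 3 1)) (Walk 0 2 4 1 3 0 3 0 2 1) (Walk 0 2 4 1 3 0 2 0 3 1) (Walk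
  0 1 2 3 4 0 2 0 2 1) (Walk 0 1 2 3 4 0 3 0 2 1)) (Orient 1 2 3 (Walk 0 1 4 2 3 0 1 2 1
  3) (Walk 0 2 4 1 3 0 1 3 1 3) (Walk 0 1 3 2 4 0 1 2 1 3) (Walk 0 2 3 1 4 0 1 3 1 3)
  (Walk 0 2 4 1 3 0 1 3 2 1) (Walk 0 2 3 1 4 0 1 3 2 1)) (Orient 0 2 3 (Walk 0 2 3 1 4 0 3
  0 2 1) (Walk 0 2 3 1 4 1 3 0 3 0) (Orient 1 2 3 (Walk 0 2 1 4 3 1 2 0 3 2) (Walk 0 1 2 4
  3 1 2 3 2 0) (Walk 0 2 1 3 4 1 2 1 3 0) (Walk 0 1 2 3 4 1 3 2 3 0) (Walk 0 1 3 2 4 2 1 2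
  3 0) (Walk 0 1 2 3 4 1 3 1 3 0)) (Walk 0 2 1 3 4 0 3 0 2 1) (Walk 0 1 2 3 4 0 2 0 2 1)
  (Walk 0 1 3 4 2 1 3 0 2 0)) (Walk 0 2 3 1 4 3 1 0 1 0) (Orient 0 2 3 (Walk 0 1 3 2 4 0 3
  0 2 1) (Walk 0 2 4 1 3 0 2 1 0 3) (Walk 0 1 2 4 3 0 2 3 0 1) (Walk 0 2 1 4 3 3 0 1 2 0)
  (Walk 0 1 2 3 4 0 2 0 2 1) (Walk 0 1 2 4 3 1 0 2 0 3)) (Walk 0 2 4 1 3 0 2 1 0 1).

Lemma avoid_refutationP :
  check true avoid_refutation [:: (0, 1, 2); (1, 0, 2); (3, 4, 5)] [::]
    [:: (2, 3); (2, 4); (2, 5)] 6.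
Proof. by vm_compute. Qed.

Lemma tetrahedron_refutationP :
  check false tetrahedron_refutation [:: (0, 1, 2)] [:: (0, 1, 3); (0, 2, 3); (1, 2, 3)] [::] 4.
Proof. by vm_compute. Qed.

(** * Configurations excluded in palettes that do not colour C_5 *)

Section Structure.
Variables (A : eqType) (P : A -> A -> A -> bool).
Hypothesis noC5 : ~ colors_C5 P.

(** For a concrete walk the hypothesis computes to true, so a configuration is excluded by naming
    the walk and giving [isT]. *)
Lemma no_walk f s r0 r1 r2 r3 r4 e0 e1 e2 e3 e4 :
  [&& uniq [:: r0; r1; r2; r3; r4] && all (ltn^~ 5) [:: r0; r1; r2; r3; r4],
      corner s r0 r1 r2 e0 e1, corner s r1 r2 r3 e1 e2,
      corner s r2 r3 r4 e2 e3, corner s r3 r4 r0 e3 e4 & corner s r4 r0 r1 e4 e0] ->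
  ~~ all (holds P f) s.
Proof. by move=> h; apply/negP => /walk_colors_C5/(_ h). Qed.

(** The walk has edge colours a, c, b, c, b. The colours may coincide; when all three are equal,
    this excludes constant triples. *)
Lemma no_rotation a b c : P a b c -> P b c a = false.
Proof.
move=> h; apply/negP => h'.
have := @no_walk (nth a [:: a; b; c]) [:: (0, 1, 2); (1, 2, 0)] 0 2 3 1 4 0 2 1 2 1 isT.
by rewrite /= /holds /= h h'.
Qed.

(** Together with [no_rotation], an order of three colours can coexist only with the two obtained by
    swapping neighbouring positions. Those two are rotations of each other, so at most two orders
    survive, and two that do differ by one adjacent swap. *)
Lemma no_reversal a b c : P a b c -> P c b a = false.
Proof.
move=> h; apply/negP => h'.
have := @no_walk (nth a [:: a; b; c]) [:: (0, 1, 2); (2, 1, 0)] 0 1 2 3 4 0 2 0 2 1 isT.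
by rewrite /= /holds /= h h'.
Qed.

(** The certificate fixes the order of the first triple; permuting the names a, b, c covers its
    other five orders, since [ordered] is symmetric. *)
Lemma no_tetrahedron a b c d :
  ordered P a b c -> ordered P a b d -> ordered P a c d -> ordered P b c d = false.
Proof.
have main a' b' c' d' : P a' b' c' -> ordered P a' b' d' -> ordered P a' c' d' ->
    ordered P b' c' d' -> False.
  move=> h1 h2 h3 h4; apply/negP: tetrahedron_refutationP.
  apply: (@check_sound _ _ predT _ noC5 _ _ _ _ _ _ _ (nth a' [:: a'; b'; c'; d'])) => //=.
    by rewrite /holds /= h1.
  by rewrite /holds_ord /= h2 h3 h4.
have ordC x y z : ordered P x y z -> ordered P y x z.
  by rewrite /ordered => /or4P[h|h|h|/or3P[h|h|h]]; rewrite h ?orbT.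
have o := ordC.
move=> h1 h2 h3; apply/negP => h4.
by case/or4P: h1 => [h|h|h|/or3P[h|h|h]]; apply: (main _ _ _ d h) => //; apply: o.
Qed.

End Structure.

(** Reversing the order of the vertices exchanges the colours of the pairs ij and jk in each triple.
    This transfers results to the mirror-image palette. *)
Lemma rev_colors_C5 (A : Type) (P : A -> A -> A -> bool) :
  colors_C5 (fun x y z => P z y x) -> colors_C5 P.
Proof.
case=> r [e [z [ri h]]].
exists (fun i => rev_ord (r i)), e, z; split; first by move=> i j /rev_ord_inj/ri.
move=> i; have := h i; rewrite /sorted_triple.
have n01 : r i != r (addmod i 1).
  by apply/negP => /eqP/ri; case: i {h} => [[|[|[|[|[|]]]]] ?] // /(congr1 val).
have n02 : r i != r (addmod i 2).
  by apply/negP => /eqP/ri; case: i {h n01} => [[|[|[|[|[|]]]]] ?] // /(congr1 val).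
have n12 : r (addmod i 1) != r (addmod i 2).
  by apply/negP => /eqP/ri; case: i {h n01 n02} => [[|[|[|[|[|]]]]] ?] // /(congr1 val).
have E (u v : 'I_5) : u != v -> (rev_ord u < rev_ord v) = ~~ (u < v).
  by move: u v => [u ult] [v vlt]; rewrite -(inj_eq val_inj) /=; lia.
rewrite !E //.
by do ![case: ltnP => ? //=] => //; lia.
Qed.

Section Doubled.
Variables (A : eqType) (P : A -> A -> A -> bool) (D : {pred A}).
Hypothesis noC5 : ~ colors_C5 P.
Hypothesis PD : forall x y z, P x y z -> [&& x \in D, y \in D & z \in D].
Hypothesis covP : forall x y, x \in D -> y \in D -> x != y -> exists z, ordered P x y z.

(** If c occurs at two positions of the third triple, one explicit walk colours C_5 whatever the
    remaining entry is. If c does not occur, [avoid_refutation] applies; this is the case that uses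
    the covering hypothesis. *)
Lemma doubled_once a b c x y z : P a b c -> P b a c -> P x y z ->
  (x == c) + (y == c) + (z == c) = 1.
Proof.
move=> h1 h2 h3.
have nw := @no_walk _ _ noC5 (nth a [:: a; b; c; x; y; z]).
have n1 : ~~ ((x == c) && (y == c)).
  apply/negP => /andP[/eqP xc /eqP yc]; subst x y.
  have := nw [:: (0, 1, 2); (1, 0, 2); (2, 2, 5)] 0 1 3 4 2 1 2 5 2 0 isT.
  by rewrite /= /holds /= h1 h2 h3.
have n2 : ~~ ((x == c) && (z == c)).
  apply/negP => /andP[/eqP xc /eqP yc]; subst x z.
  have := nw [:: (0, 1, 2); (1, 0, 2); (2, 4, 2)] 0 1 2 3 4 1 2 2 2 0 isT.
  by rewrite /= /holds /= h1 h2 h3.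
have n3 : ~~ ((y == c) && (z == c)).
  apply/negP => /andP[/eqP xc /eqP yc]; subst y z.
  have := nw [:: (0, 1, 2); (1, 0, 2); (3, 2, 2)] 0 3 1 2 4 1 2 3 2 0 isT.
  by rewrite /= /holds /= h1 h2 h3.
have n0 : ~~ [&& x != c, y != c & z != c].
  apply/negP => /and3P[xc yc zc].
  have /and3P[aD bD cD] := PD h1; have /and3P[xD yD zD] := PD h3.
  apply/negP: avoid_refutationP.
  apply: (@check_sound _ _ D _ noC5 PD _ _ _ _ _ _ (nth a [:: a; b; c; x; y; z])) => //=.
  - by do 6?[case => //=]; move=> n; rewrite nth_nil.
  - by rewrite /holds /= h1 h2 h3.
  - by rewrite !(eq_sym c) xc yc zc.
by move: n0 n1 n2 n3; do 3!case: (_ == c).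
Qed.
End Doubled.

(** * Weighted density of C5-free palettes *)

Local Open Scope ring_scope.

Section PaletteWeight.
Variables (R : realFieldType) (A : finType).
Implicit Types (P : A -> A -> A -> bool) (w : A -> R).

(** The Lagrangian polynomial of the palette; at the constant weight 1 it counts the triples. *)
Definition weight P w : R := \sum_x \sum_y \sum_z (P x y z)%:R * (w x * w y * w z).

Lemma sum_cube w : \sum_x \sum_y \sum_z (w x * w y * w z) = (\sum_x w x) ^+ 3.
Proof.
rewrite !exprS expr0 mulr1 mulr_suml; apply: eq_bigr => x _.
rewrite mulr_suml mulr_sumr; apply: eq_bigr => y _.
by rewrite !mulr_sumr; apply: eq_bigr => z _; rewrite mulrA.
Qed.

Lemma weight_le_cube P w : (forall x, 0 <= w x) -> weight P w <= (\sum_x w x) ^+ 3.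
Proof.
move=> w0; rewrite -sum_cube; do 3 apply: ler_sum => ? _.
by rewrite ler_piMl ?mulr_ge0 // ?w0 // lern1 leq_b1.
Qed.

(** The homogeneous form of the maximum of y(1-y)^2, attained at y = 1/3: the difference has a
    double zero at s = 2t. This is the source of 4/27. *)
Lemma cubic_max (s t : R) : 0 <= s -> 0 <= t -> t * s ^+ 2 <= 4 / 27 * (t + s) ^+ 3.
Proof.
move=> s0 t0; rewrite -subr_ge0.
have -> : 4 / 27 * (t + s) ^+ 3 - t * s ^+ 2 = (s - 2 * t) ^+ 2 * (4 * s + t) / 27 by field.
by rewrite mulr_ge0 ?invr_ge0 // mulr_ge0 ?sqr_ge0 // addr_ge0 // mulr_ge0.
Qed.

Lemma sum_delta (F : A -> R) c : \sum_x F x * (x == c)%:R = F c.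
Proof.
rewrite (bigD1 c) //= eqxx mulr1 big1 ?addr0 // => x /negbTE ->.
by rewrite mulr0.
Qed.

(** Deleting the single c from a triple leaves a pair (a,b), and [m a b] counts the possible
    positions of c. The pairs (a,b) and (b,a) together account for all six orders of a, b, c, of
    which at most two lie in P, so [m] is at most 1 on average. *)
Lemma once_bound P w c : ~ colors_C5 P -> (forall x, 0 <= w x) ->
  (forall x y z, P x y z -> (x == c) + (y == c) + (z == c) = 1)%N ->
  weight P w <= w c * (\sum_(x | x != c) w x) ^+ 2.
Proof.
move=> noC5 w0 once.
pose m a b := (P c a b + P a c b + P a b c)%N.
pose w' v := if v == c then 0 else w v.
have Sw' : \sum_(x | x != c) w x = \sum_x w' x.
  by rewrite big_mkcond; apply: eq_bigr => x _; rewrite /w'; case: eqP.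
have E : weight P w = w c * \sum_a \sum_b (m a b)%:R * (w' a * w' b).
  pose F x y z := (P x y z)%:R * (w x * w y * w z).
  (* On P the number of occurrences of c is 1, so it can be inserted as a factor; each of its three
     indicators then fixes one summation variable at c. *)
  have -> : weight P w = \sum_x \sum_y \sum_z
     (F x y z * (x == c)%:R + F x y z * (y == c)%:R + F x y z * (z == c)%:R).
    do 3 (apply: eq_bigr => ? _); rewrite -!mulrDr -!natrD /F.
    by case Pxyz: (P _ _ _); rewrite ?mul0r // (once _ _ _ Pxyz) mulr1.
  have -> : \sum_x \sum_y \sum_z
     (F x y z * (x == c)%:R + F x y z * (y == c)%:R + F x y z * (z == c)%:R) =
     \sum_a \sum_b (F c a b + F a c b + F a b c).
    transitivity (\sum_x (\sum_y \sum_z F x y z) * (x == c)%:R +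
       (\sum_x \sum_y (\sum_z F x y z) * (y == c)%:R +
       \sum_x \sum_y \sum_z F x y z * (z == c)%:R)).
      rewrite -!big_split /=; apply: eq_bigr => x _.
      rewrite mulr_suml -!big_split /=; apply: eq_bigr => y _.
      by rewrite !mulr_suml -!big_split /=; apply: eq_bigr => z _; rewrite addrA.
    rewrite sum_delta -!big_split /=; apply: eq_bigr => a _.
    rewrite sum_delta -!big_split /=; apply: eq_bigr => b _.
    by rewrite sum_delta addrA.
  rewrite mulr_sumr; apply: eq_bigr => a _; rewrite mulr_sumr; apply: eq_bigr => b _.
  rewrite /F /m /w'.
  have na : a == c -> [/\ P c a b = false, P a c b = false & P a b c = false].
    by move=> /eqP ->; split; apply/negP => /once; rewrite !eqxx; case: (b == c).
  have nb : b == c -> [/\ P c a b = false, P a c b = false & P a b c = false].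
    by move=> /eqP ->; split; apply/negP => /once; rewrite !eqxx; case: (a == c).
  case: eqP => [/eqP /na[-> -> ->]|_]; first by rewrite !mul0r !addr0 mulr0.
  case: eqP => [/eqP /nb[-> -> ->]|_]; first by rewrite !mul0r !addr0 mulr0.
  by rewrite !natrD; ring.
rewrite E Sw' ler_wpM2l //.
have w'0 x : 0 <= w' x by rewrite /w'; case: ifP.
have sq : (\sum_x w' x) ^+ 2 = \sum_a \sum_b w' a * w' b.
  by rewrite expr2 mulr_suml; apply: eq_bigr => a _; rewrite mulr_sumr.
have swap : \sum_a \sum_b (m a b)%:R * (w' a * w' b) =
            \sum_a \sum_b (m b a)%:R * (w' a * w' b).
  by rewrite exchange_big /=; do 2 apply: eq_bigr => ? _; rewrite (mulrC (w' _)).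
rewrite -(ler_pM2l (ltr0n R 2)) mulr_natl mulr2n {2}swap sq -big_split mulr_sumr.
apply: ler_sum => a _; rewrite -big_split mulr_sumr; apply: ler_sum => b _ /=.
rewrite -mulrDl ler_wpM2r ?mulr_ge0 // -natrD ler_nat /m.
have rot x y z : ~~ (P x y z && P y z x).
  by apply/negP => /andP[h]; rewrite (no_rotation noC5 h).
have rv x y z : ~~ (P x y z && P z y x).
  by apply/negP => /andP[h]; rewrite (no_reversal noC5 h).
move: (rot a b c) (rot b c a) (rot c a b) (rot a c b) (rot c b a) (rot b a c)
  (rv a b c) (rv b c a) (rv c a b).
by do 6!case: (P _ _ _).
Qed.

Definition undoubled P :=
  forall a b c, ~~ (P a b c && P b a c) /\ ~~ (P c a b && P c b a).

Lemma weightC12 P w : weight (fun x y z => P y x z) w = weight P w.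
Proof.
rewrite /weight exchange_big; do 3 (apply: eq_bigr => ? _) => /=.
by rewrite (mulrC (w _)).
Qed.

Lemma weightC23 P w : weight (fun x y z => P x z y) w = weight P w.
Proof.
apply: eq_bigr => x _; rewrite exchange_big; do 2 (apply: eq_bigr => ? _) => /=.
by rewrite mulrAC.
Qed.

(** Without doubled triples at most one of the six orders lies in P, so six times the weight is at
    most that of [ordered P]. Averaging over four colours, of whose four triples at most three are
    ordered, bounds the latter by 3/4 of the cube. The constant is 1/6 times 3/4. *)
Lemma undoubled_bound P w : ~ colors_C5 P -> (forall x, 0 <= w x) -> undoubled P ->
  weight P w <= 1 / 8 * (\sum_x w x) ^+ 3.
Proof.
move=> noC5 w0 und; set S := \sum_x w x.
have S0 : 0 <= S by apply: sumr_ge0.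
have q6 : 6 * weight P w <= weight (ordered P) w.
  have -> : 6 * weight P w = weight P w + weight (fun x y z => P x z y) w +
     weight (fun x y z => P y x z) w + weight (fun x y z => P z x y) w +
     weight (fun x y z => P y z x) w + weight (fun x y z => P z y x) w.
    have e1 : weight (fun x y z => P x z y) w = weight P w := weightC23 P w.
    have e2 : weight (fun x y z => P y x z) w = weight P w := weightC12 P w.
    have e3 : weight (fun x y z => P z x y) w = weight P w :=
      etrans (weightC23 (fun x y z => P y x z) w) e2.
    have e4 : weight (fun x y z => P y z x) w = weight P w :=
      etrans (weightC12 (fun x y z => P x z y) w) e1.
    have e5 : weight (fun x y z => P z y x) w = weight P w :=
      etrans (weightC12 (fun x y z => P z x y) w) e3.
    rewrite e1 e2 e3 e4 e5.
    by ring.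
  rewrite /weight -!big_split; apply: ler_sum => x _.
  rewrite -!big_split; apply: ler_sum => y _.
  rewrite -!big_split; apply: ler_sum => z _ /=.
  rewrite -!mulrDl ler_wpM2r ?mulr_ge0 // -!natrD ler_nat /ordered.
  have rot a b c : ~~ (P a b c && P b c a).
    by apply/negP => /andP[h]; rewrite (no_rotation noC5 h).
  have rv a b c : ~~ (P a b c && P c b a).
    by apply/negP => /andP[h]; rewrite (no_reversal noC5 h).
  have [u1 v1] := und x y z; have [u2 v2] := und y z x; have [u3 v3] := und z x y.
  move: (rot x y z) (rot y z x) (rot z x y) (rot x z y) (rot z y x) (rot y x z)
    (rv x y z) (rv y z x) (rv z x y) u1 v1 u2 v2 u3 v3.
  by do 6!case: (P _ _ _).
pose Q := ordered P; pose q := weight Q w.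
pose W x y z t := w x * w y * w z * w t.
have T1 : \sum_x \sum_y \sum_z \sum_t (Q x y z)%:R * W x y z t = q * S.
  rewrite mulr_suml; apply: eq_bigr => x _; rewrite mulr_suml; apply: eq_bigr => y _.
  rewrite mulr_suml; apply: eq_bigr => z _; rewrite mulr_sumr; apply: eq_bigr => t _.
  by rewrite /W mulrA.
have T2 : \sum_x \sum_y \sum_z \sum_t (Q x y t)%:R * W x y z t = q * S.
  rewrite -T1; do 2 (apply: eq_bigr => ? _); rewrite exchange_big.
  by do 2 (apply: eq_bigr => ? _) => /=; rewrite /W (mulrAC (_ * _)).
have T3 : \sum_x \sum_y \sum_z \sum_t (Q x z t)%:R * W x y z t = q * S.
  rewrite -T2; apply: eq_bigr => ? _; rewrite exchange_big.
  by do 3 (apply: eq_bigr => ? _) => /=; rewrite /W (mulrAC (w _)).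
have T4 : \sum_x \sum_y \sum_z \sum_t (Q y z t)%:R * W x y z t = q * S.
  rewrite -T3 exchange_big.
  by do 4 (apply: eq_bigr => ? _) => /=; rewrite /W (mulrC (w _)).
have S4 : \sum_x \sum_y \sum_z \sum_t W x y z t = S ^+ 4.
  rewrite exprSr -sum_cube mulr_suml; apply: eq_bigr => x _.
  rewrite mulr_suml; apply: eq_bigr => y _; rewrite mulr_suml; apply: eq_bigr => z _.
  by rewrite mulr_sumr.
have q4 : 4 * (q * S) <= 3 * S ^+ 4.
  have -> : 4 * (q * S) = q * S + q * S + q * S + q * S by ring.
  rewrite -{1}T1 -{1}T2 -{1}T3 -T4 -S4 -!big_split mulr_sumr; apply: ler_sum => x _.
  rewrite -!big_split mulr_sumr; apply: ler_sum => y _.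
  rewrite -!big_split mulr_sumr; apply: ler_sum => z _.
  rewrite -!big_split mulr_sumr; apply: ler_sum => t _ /=.
  rewrite -!mulrDl ler_wpM2r ?mulr_ge0 // -!natrD ler_nat.
  have : ~~ [&& Q x y z, Q x y t, Q x z t & Q y z t].
    by apply/negP => /and4P[h1 h2 h3]; rewrite /Q (no_tetrahedron noC5 h1).
  by move: (Q x y z) (Q x y t) (Q x z t) (Q y z t) => [] [] [] [].
have [S00|Sn0] := eqVneq S 0.
  by have := weight_le_cube P w0; rewrite -/S S00 !expr0n /= mulr0.
have Sgt : 0 < S by rewrite lt_neqAle eq_sym Sn0.
rewrite -(ler_pM2r Sgt).
have -> : 1 / 8 * S ^+ 3 * S = 1 / 8 * S ^+ 4 by ring.
have : 6 * weight P w * S <= q * S by rewrite ler_wpM2r.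
move: q4; lra.
Qed.

Lemma weight_sub P P' w :
  (forall x y z, [&& w x != 0, w y != 0 & w z != 0] -> P x y z = P' x y z) ->
  weight P w = weight P' w.
Proof.
move=> h; apply: eq_bigr => x _; apply: eq_bigr => y _; apply: eq_bigr => z _.
have [x0|x0] := eqVneq (w x) 0; first by rewrite x0 !mul0r !mulr0.
have [y0|y0] := eqVneq (w y) 0; first by rewrite y0 mulr0 mul0r !mulr0.
have [z0|z0] := eqVneq (w z) 0; first by rewrite z0 !mulr0.
by rewrite h ?x0 ?y0 ?z0.
Qed.

(** * Moving weight between colours *)

Definition merge w x y v : R := if v == x then w x + w y else if v == y then 0 else w v.

Lemma merge_ge0 w x y v : (forall v, 0 <= w v) -> 0 <= merge w x y v.
Proof. by move=> w0; rewrite /merge; case: ifP => _; [rewrite addr_ge0|case: ifP]. Qed.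

Lemma sum_merge w x y : x != y -> \sum_v merge w x y v = \sum_v w v.
Proof.
move=> xy; have yx : y != x by rewrite eq_sym.
rewrite (bigD1 x) // (bigD1 y) //= [RHS](bigD1 x) // [in RHS](bigD1 y) //=.
rewrite /merge !eqxx (negbTE yx) add0r addrA; congr (_ + _).
by apply: eq_bigr => v /andP[/negbTE -> /negbTE ->].
Qed.

Lemma merge_supp w x y : x != y -> w x != 0 -> w y != 0 ->
  (#|[pred v | merge w x y v != 0%R]| < #|[pred v | w v != 0%R]|)%N.
Proof.
move=> xy x0 y0; apply: proper_card; apply/properP; split.
  apply/subsetP => v; rewrite !inE /merge.
  have [->//|_] := eqVneq v x; have [->|//] := eqVneq v y; by rewrite eqxx.
have /negbTE yx : y != x by rewrite eq_sym.
by exists y; rewrite !inE // /merge yx !eqxx.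
Qed.

(** An entry equal to x grows from [w x] to [w x + w y], and no other entry shrinks because y is not
    among them. *)
Lemma merge_le_half w x y a b c : (forall v, 0 <= w v) ->
  x \in [:: a; b; c] -> y \notin [:: a; b; c] ->
  (w x + w y) * (w a * w b * w c) <=
    w x * (merge w x y a * merge w x y b * merge w x y c).
Proof.
move=> w0 xin; rewrite !inE !negb_or => /and3P[ya yb yc].
have m v : y != v -> w v <= merge w x y v.
  by rewrite /merge eq_sym => /negbTE ->; case: eqP => // ->; rewrite lerDl.
have mx : merge w x y x = w x + w y by rewrite /merge eqxx.
have m0 v := merge_ge0 x y v w0.
move: xin; rewrite !inE => /or3P[] /eqP xe; rewrite -xe mx.
- have -> : (w x + w y) * (w x * w b * w c) = w x * ((w x + w y) * w b * w c) by ring.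
  by rewrite !(ler_wpM2l, ler_pM) ?mulr_ge0 ?addr_ge0 ?m.
- have -> : (w x + w y) * (w a * w x * w c) = w x * (w a * (w x + w y) * w c) by ring.
  by rewrite !(ler_wpM2l, ler_pM) ?mulr_ge0 ?addr_ge0 ?m.
- have -> : (w x + w y) * (w a * w b * w x) = w x * (w a * w b * (w x + w y)) by ring.
  by rewrite !(ler_wpM2l, ler_pM) ?mulr_ge0 ?addr_ge0 ?m.
Qed.

(* The weight is convex along the segment moving weight between two colours that lie in no
   common triple; the inequality already holds for each triple separately. *)
Lemma merge_le w x y a b c : (forall v, 0 <= w v) ->
  ~~ ((x \in [:: a; b; c]) && (y \in [:: a; b; c])) ->
  (w x + w y) * (w a * w b * w c) <=
    w x * (merge w x y a * merge w x y b * merge w x y c) +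
    w y * (merge w y x a * merge w y x b * merge w y x c).
Proof.
move=> w0; have m0 u v t := merge_ge0 u v t w0.
have [xin|xin] := boolP (x \in _) => /= yin.
  apply: le_trans (merge_le_half w0 xin yin) _.
  by rewrite lerDl !mulr_ge0.
have [{}yin|{}yin] := boolP (y \in [:: a; b; c]).
  rewrite [w x + w y]addrC; apply: le_trans (merge_le_half w0 yin xin) _.
  by rewrite lerDr !mulr_ge0.
have e u v : u \notin [:: a; b; c] -> v \notin [:: a; b; c] ->
    merge w u v a * merge w u v b * merge w u v c = w a * w b * w c.
  rewrite !inE !negb_or /merge => /and3P[h1 h2 h3] /and3P[k1 k2 k3].
  by rewrite ![_ == u]eq_sym ![_ == v]eq_sym !ifN.
by rewrite !e // -mulrDl.
Qed.

Lemma ordered_mem P x y a b c : P a b c -> x != y ->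
  x \in [:: a; b; c] -> y \in [:: a; b; c] -> exists z, ordered P x y z.
Proof.
rewrite /ordered !inE => Pabc xy /or3P[] /eqP xe /or3P[] /eqP ye; subst x y;
  rewrite ?eqxx // in xy *.
all: by [exists a; rewrite Pabc ?orbT|exists b; rewrite Pabc ?orbT|exists c; rewrite Pabc ?orbT].
Qed.

Lemma sub_colors_C5 P P' : (forall x y z, P' x y z -> P x y z) -> colors_C5 P' -> colors_C5 P.
Proof.
move=> h [r [e [z [ri H]]]]; exists r, e, z; split=> // i.
by move: (H i); rewrite /sorted_triple; do ![case: ifP => _]; apply: h.
Qed.

(** Induction on the size of the support. If two colours of the support are uncovered, the weight is
    at most a weighted mean of the two merged weights, each of smaller support and equal total. *)
Theorem palette_bound P w : ~ colors_C5 P -> (forall x, 0 <= w x) ->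
  weight P w <= 4 / 27 * (\sum_x w x) ^+ 3.
Proof.
move=> noC5; have [n] := ubnP #|[pred v | w v != 0]|.
elim: n w => // n IH w /ltnSE supp_w w0.
pose D := [pred v | w v != 0].
(* Restricting to the support keeps the weight and turns covering into a property of the support
   alone. *)
pose P' x y z := [&& P x y z, x \in D, y \in D & z \in D].
have -> : weight P w = weight P' w.
  by apply: weight_sub => x y z h; rewrite /P' !inE h andbT.
have P'P x y z : P' x y z -> P x y z by case/andP.
have noC5' : ~ colors_C5 P' by move/(sub_colors_C5 P'P).
have S0 : 0 <= \sum_x w x by apply: sumr_ge0.
have [/existsP[x /existsP[y /and4P[xD yD xy /forallP unc]]]|cov] :=
    boolP [exists x, exists y, [&& x \in D, y \in D, x != y & [forall z, ~~ ordered P' x y z]]].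
  have Wgt : 0 < w x + w y.
    by rewrite ltr_wpDr ?w0 // lt_neqAle eq_sym; move: xD; rewrite inE w0 => ->.
  rewrite -(ler_pM2l Wgt).
  have le1 : (w x + w y) * weight P' w <=
      w x * weight P' (merge w x y) + w y * weight P' (merge w y x).
    rewrite /weight !mulr_sumr -big_split; apply: ler_sum => a _.
    rewrite !mulr_sumr -big_split; apply: ler_sum => b _.
    rewrite !mulr_sumr -big_split; apply: ler_sum => c _ /=.
    case Pabc: (P' a b c); last by rewrite !mul0r !mulr0 addr0.
    rewrite !mul1r; apply: merge_le => //; apply/negP => /andP[xin yin].
    by have [z] := ordered_mem Pabc xy xin yin; apply/negP/unc.
  have b u v : u \in D -> v \in D -> u != v ->
      weight P' (merge w u v) <= 4 / 27 * (\sum_x w x) ^+ 3.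
    rewrite !inE => uD vD uv; rewrite -(sum_merge w uv).
    apply: le_trans (IH _ _ _); last by move=> t; apply: merge_ge0.
      (* The induction hypothesis concerns [P], which contains [P']. *)
      do 3 (apply: ler_sum => ? _); rewrite ler_wpM2r ?mulr_ge0 ?merge_ge0 // ler_nat.
      by case p: (P' _ _ _) => //; rewrite (P'P _ _ _ p).
    exact: leq_trans (merge_supp uv uD vD) supp_w.
  apply: le_trans le1 _; rewrite mulrDl.
  by rewrite lerD ?ler_wpM2l ?b // eq_sym.
have covP x y : x \in D -> y \in D -> x != y -> exists z, ordered P' x y z.
  move=> xD yD xy; apply/existsP; apply: contraNT cov => /existsPn h.
  apply/existsP; exists x; apply/existsP; exists y; rewrite xD yD xy /=.
  exact/forallP.
have P'D x y z : P' x y z -> [&& x \in D, y \in D & z \in D] by case/andP.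
have once_case c : (forall x y z, P' x y z -> (x == c) + (y == c) + (z == c) = 1)%N ->
    weight P' w <= 4 / 27 * (\sum_x w x) ^+ 3.
  move=> /(once_bound noC5' w0) h; apply: le_trans h _.
  by rewrite [X in _ <= _ * X ^+ 3](bigD1 c) //= cubic_max // sumr_ge0.
have [/existsP[a /existsP[b /existsP[c]]]|nd] :=
    boolP [exists a, exists b, exists c, (P' a b c && P' b a c) || (P' c a b && P' c b a)].
  case/orP=> /andP[h1 h2]; apply: (once_case c) => x y z Pxyz.
    exact: doubled_once noC5' P'D covP _ _ _ _ _ _ h1 h2 Pxyz.
  (* The mirror doubling becomes the first kind of doubling in the reversed palette. *)
  pose Pr x y z := P' z y x.
  have noC5r : ~ colors_C5 Pr by move/rev_colors_C5.
  have PrD u v t : Pr u v t -> [&& u \in D, v \in D & t \in D].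
    by move/P'D => /and3P[-> -> ->].
  have covr u v : u \in D -> v \in D -> u != v -> exists t, ordered Pr u v t.
    move=> uD vD uv; have [t ot] := covP _ _ uD vD uv; exists t.
    by move: ot; rewrite /ordered /Pr; do 6!case: (P' _ _ _).
  have /= := doubled_once noC5r PrD covr (h2 : Pr a b c) (h1 : Pr b a c) (Pxyz : Pr z y x).
  by rewrite addnC [X in (_ + X)%N = _]addnC addnA.
have und : undoubled P'.
  move=> a b c; move: nd => /existsPn/(_ a)/existsPn/(_ b)/existsPn/(_ c).
  by rewrite negb_or => /andP.
apply: le_trans (undoubled_bound noC5' w0 und) _.
by rewrite ler_wpM2r ?exprn_ge0 //; lra.
Qed.

End PaletteWeight.
Local Close Scope ring_scope.

(** * Ramsey theorem and spaced sublists *)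

Section EndHomogeneous.
Variables (C : finType) (T : eqType) (chi : seq T -> C) (r : nat).

(** The colour of a sublist of r+1 entries depends only on its first entry, and [cs] records that
    dependence. *)
Fixpoint end_homogeneous (s : seq T) (cs : seq C) : Prop :=
  match s, cs with
  | x :: s', c :: cs' =>
    (forall t, subseq t s' -> size t = r -> chi (x :: t) = c) /\ end_homogeneous s' cs'
  | _, _ => True
  end.

Lemma end_homogeneous_mask s cs c : end_homogeneous s cs ->
  forall t, subseq t (mask [seq c' == c | c' <- cs] s) -> size t = r.+1 -> chi t = c.
Proof.
elim: s cs => [|x s IH] [|c' cs] /=; do ?by move=> _ [|y t].
case=> hx /IH{}IH; have [c'c|//] := eqVneq c' c.
case=> [//|y t] /=; case: eqP => [->|_]; last exact: (IH (y :: t)).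
move=> ts [st]; rewrite -c'c; apply: hx => //.
by apply: subseq_trans ts (mask_subseq _ _).
Qed.

Lemma pigeonhole_count (cs : seq C) n : n * #|C| < size cs -> exists c, n <= count_mem c cs.
Proof.
move=> h; apply/existsP; apply: contraTT h => /existsPn h; rewrite -leqNgt.
have -> : size cs = \sum_c count_mem c cs.
  elim: cs {h} => [|d cs IH] /=; first by rewrite big1.
  by rewrite big_split -IH /= (bigD1 d) //= eqxx big1 // => c; rewrite eq_sym => /negbTE ->.
rewrite mulnC -sum_nat_const; apply: leq_sum => c _.
by have := h c; rewrite -ltnNge => /ltnW.
Qed.
End EndHomogeneous.

(** Taking one entry at a time and applying the case r to the rest, with the entry prepended, builds
    an end-homogeneous list. Length n#|C|+1 then forces n entries with one recorded colour. Sublists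
    keep the order of the indices, and [N] is uniform in the type and the colouring. *)
Lemma ramsey (C : finType) (r n : nat) : exists N, forall (T : eqType) (chi : seq T -> C) s,
  N <= size s -> exists s' c, [/\ subseq s' s, size s' = n &
    forall t, subseq t s' -> size t = r -> chi t = c].
Proof.
elim: r n => [|r IH] n.
  exists n => T chi s ns; exists (take n s), (chi [::]).
  split; [exact: take_subseq | by rewrite size_takel | by move=> t _ /size0nil ->].
have [N HN] : exists N, forall (T : eqType) (chi : seq T -> C) s, N <= size s ->
    exists s' cs, [/\ subseq s' s, size s' = (n * #|C|).+1, size cs = (n * #|C|).+1 &
      end_homogeneous chi r s' cs].
  elim: (n * #|C|).+1 => [|m [M HM]].
    by exists 0 => T chi s _; exists [::], [::]; rewrite sub0seq.
  have [N HN] := IH M; exists N.+1 => T chi [//|x s] ns.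
  have [s1 [c [s1s ss1 h1]]] := HN T (fun t => chi (x :: t)) s ns.
  have [s2 [cs [s2s1 ss2 scs h2]]] := HM T chi s1 (eq_leq (esym ss1)).
  have s2s := subseq_trans s2s1 s1s.
  exists (x :: s2), (c :: cs); rewrite /= eqxx ss2 scs; split=> //; split=> // t ts.
  by apply: h1; apply: subseq_trans ts s2s1.
exists N => T chi s ns; have [s1 [cs [s1s ss1 scs h]]] := HN T chi s ns.
have [c nc] : exists c, n <= count_mem c cs by apply: pigeonhole_count; rewrite scs.
pose s2 := mask [seq c' == c | c' <- cs] s1.
have ss2 : n <= size s2.
  by rewrite size_mask ?size_map ?ss1 // count_map.
exists (take n s2), c; split.
- exact: subseq_trans (take_subseq _ _) (subseq_trans (mask_subseq _ _) s1s).
- by rewrite size_takel.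
- move=> t ts; apply: (end_homogeneous_mask h).
  exact: subseq_trans ts (take_subseq _ _).
Qed.

(** Homogeneity speaks of sublists of one fixed size; this brings smaller ones to that size. *)
Lemma subseq_pad (T : eqType) (A Z : seq T) m : subseq A Z -> size A <= m <= size Z ->
  exists K, [/\ subseq A K, subseq K Z & size K = m].
Proof.
elim: Z A m => [|z Z IH] A m.
  by rewrite subseq0 leqn0 => /eqP -> /andP[_ /eqP ->]; exists [::].
case: m => [|m]; first by rewrite leqn0 => _ /andP[/nilP -> _]; exists [::]; rewrite sub0seq.
case: A => [|a A] AZ /andP[Am mZ].
  by exists (take m.+1 (z :: Z)); rewrite sub0seq take_subseq size_takel.
have [zm|zm] := leqP (size Z) m.
  exists (z :: Z); split=> //; apply/eqP; rewrite eqn_leq mZ andbT; exact: zm.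
move: AZ => /=; case: eqP => [->|_] AZ.
  have [K [AK KZ sK]] := IH A m AZ (introT andP (conj Am (ltnW zm))).
  by exists (z :: K); rewrite /= eqxx sK.
have [K [AK KZ sK]] := IH (a :: A) m.+1 AZ (introT andP (conj Am zm)).
exists K; split=> //; exact: subseq_trans KZ (subseq_cons _ _).
Qed.

(** Repeatedly skip m entries and keep the next: each kept entry costs m+1, and m remain at the end.
    The gaps leave room for padding on every side of one or two marked entries. *)
Lemma spaced_subseq (T : eqType) (m k : nat) (S : seq T) : k * m.+1 + m <= size S ->
  exists S', [/\ subseq S' S, size S' = k,
    forall A i C, S' = A ++ i :: C -> exists Z1 Z3, [/\ S = Z1 ++ i :: Z3,
      subseq A Z1, subseq C Z3, m <= size Z1 & m <= size Z3] &
    forall A i B j C, S' = A ++ i :: B ++ j :: C ->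
      exists Z1 Z2 Z3, [/\ S = Z1 ++ i :: Z2 ++ j :: Z3,
        [/\ subseq A Z1, subseq B Z2 & subseq C Z3] &
        [/\ m <= size Z1, m <= size Z2 & m <= size Z3]]].
Proof.
elim: k S => [|k IH] S hS.
  by exists [::]; rewrite sub0seq; split=> //; do ?case.
have sd : m < size S by move: hS; rewrite mulSn; lia.
case: S hS sd => [//|s0 S0] hS sd; set S := s0 :: S0 in hS sd *.
pose P := take m S; pose x := nth s0 S m; pose S1 := drop m.+1 S.
have SE : S = P ++ x :: S1 by rewrite /P /x /S1 -drop_nth // cat_take_drop.
have sP : size P = m by rewrite size_takel // ltnW.
have hS1 : k * m.+1 + m <= size S1 by rewrite size_drop; move: hS; rewrite mulSn; lia.
have mS1 : m <= size S1 by apply: leq_trans hS1; rewrite leq_addl.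
have [S' [sub sz one two]] := IH S1 hS1; exists (x :: S'); split.
- by rewrite SE -[x :: S']cat0s cat_subseq ?sub0seq //= eqxx.
- by rewrite /= sz.
- case=> [|a A] i C [xi S'E].
    by exists P, S1; rewrite sub0seq -xi -S'E sP.
  have [Z1 [Z3 [S1E AZ CZ m1 m3]]] := one _ _ _ S'E.
  exists (P ++ x :: Z1), Z3; rewrite SE S1E -catA; split=> //.
    by rewrite xi -[a :: A]cat0s cat_subseq ?sub0seq //= eqxx.
  by rewrite size_cat sP leq_addr.
- case=> [|a A] i B j C [xi S'E].
    have [Z1 [Z3 [S1E AZ CZ m1 m3]]] := one _ _ _ S'E.
    by exists P, Z1, Z3; rewrite sub0seq -xi SE {1}S1E sP.
  have [Z1 [Z2 [Z3 [S1E [AZ BZ CZ] [m1 m2 m3]]]]] := two _ _ _ _ _ S'E.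
  exists (P ++ x :: Z1), Z2, Z3; rewrite SE S1E -catA; split=> //; split=> //.
    by rewrite xi -[a :: A]cat0s cat_subseq ?sub0seq //= eqxx.
  by rewrite size_cat sP leq_addr.
Qed.

(** * Averaging and popular thresholds *)

Section Labels.
Variable R : realFieldType.
Local Open Scope ring_scope.

(** If F were negative wherever u is positive, mean zero would force u to vanish. Positivity of
    [u x] later places the label in the right part. *)
Lemma mean_witness (V : finType) (u F : V -> R) : (forall x, 0 <= u x) ->
  \sum_x u x = 1 -> \sum_x u x * F x = 0 -> exists2 x, 0 < u x & 0 <= F x.
Proof.
move=> u0 u1 uF.
have [/existsP[x /andP[]]|/existsPn h] := boolP [exists x, (0 < u x) && (0 <= F x)].
  by exists x.
have neg x : u x * F x <= 0.
  have := h x; rewrite negb_and -!ltNge -leNgt => /orP[ux|Fx].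
    by have -> : u x = 0 by [apply: le_anti; rewrite u0 ux]; rewrite mul0r.
  by rewrite mulr_ge0_le0 // ltW.
have z x : u x * F x = 0.
  apply: le_anti; rewrite neg /= -uF (bigD1 x) //= gerDl.
  by apply: sumr_le0 => y _.
have u00 x : u x = 0.
  have := h x; rewrite negb_and -!ltNge -leNgt => /orP[ux|Fx].
    by apply: le_anti; rewrite u0 ux.
  by move/eqP: (z x); rewrite mulf_eq0 (lt_eqF Fx) orbF => /eqP.
by move: u1; rewrite big1 // => /eqP; rewrite eq_sym oner_eq0.
Qed.

(** For q from 0 to 4K the levels run from -3 to 1 in steps of 1/K. *)
Definition grid (K q : nat) : R := q%:R / K%:R - 3.

(** Let t be the mean minus 1/K. Values are at most 1 and 1 - t is at most 3, so at least a fraction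
    1/(3K) of the values reach t. Rounding t down to the grid loses another 1/K, whence 2/K. *)
Lemma popular_threshold (T : eqType) (K m : nat) (Z : seq T) (f : T -> R) :
  (0 < K)%N -> (0 < m)%N -> size Z = (3 * K * m)%N -> (forall k, k \in Z -> `|f k| <= 1) ->
  exists q : 'I_(4 * K).+1, \sum_(k <- Z) f k <= (grid K q + 2 / K%:R) * (size Z)%:R /\
    (m <= count (fun k => (grid K q <= f k)%R) Z)%N.
Proof.
move=> K0 m0 sZ f1; set M : R := (size Z)%:R; set S := \sum_(k <- Z) f k.
have Kp : 0 < K%:R :> R by rewrite ltr0n.
have Mp : 0 < M by rewrite /M sZ ltr0n !muln_gt0 K0 m0.
have iKp : 0 < K%:R^-1 :> R by rewrite invr_gt0.
have iKl : K%:R^-1 <= 1 :> R by rewrite invf_le1 // ler1n.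
have SM : - M <= S <= M.
  rewrite -ler_norml /S; apply: le_trans (ler_norm_sum _ _ _) _.
  rewrite /M -sum1_size natr_sum [leLHS]big_seq [leRHS]big_seq; apply: ler_sum => k kZ.
  exact: f1.
pose t := S / M - K%:R^-1.
have tl : -2 <= t <= 1.
  have : -1 <= S / M <= 1 by rewrite ler_pdivlMr // ler_pdivrMr // mulN1r mul1r.
  rewrite /t; lra.
have exq : exists q, (grid K q <= t)%R.
  by exists 0%N; rewrite /grid mul0r; move: tl; lra.
have bq q : (grid K q <= t)%R -> (q <= 4 * K)%N.
  rewrite /grid => h.
  have : q%:R / K%:R <= 4 :> R by move: tl; lra.
  by rewrite ler_pdivrMr // -natrM ler_nat.
have [q qt qmax] := ex_maxnP exq bq.
exists (Ordinal (bq q qt : (q < (4 * K).+1)%N)) => /=; split.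
  have tq : t < grid K q + K%:R^-1.
    rewrite ltNge; apply/negP => h; have /qmax : grid K q.+1 <= t.
      by apply: le_trans h; rewrite /grid -natr1 mulrDl mul1r; lra.
    by rewrite ltnn.
  by rewrite -ler_pdivrMr //; move: tq; rewrite /t; lra.
set c := count _ _.
have cS : S <= c%:R * (1 - t) + M * t.
  rewrite /S /c /M -sum1_count -sum1_size !natr_sum !mulr_suml [X in _ <= X + _]big_mkcond -big_split /=.
  rewrite [leLHS]big_seq [leRHS]big_seq; apply: ler_sum => k kZ.
  have fk : f k <= 1 by have := f1 k kZ; rewrite ler_norml => /andP[].
  by case: ifP => [_|/negbT]; rewrite -?ltNge; move: qt; lra.
have : M * K%:R^-1 <= c%:R * (1 - t).
  have -> : M / K%:R = S - M * t by rewrite /t mulrBr mulrCA divff ?gt_eqF // mulr1; ring.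
  by move: cS; lra.
have -> : M / K%:R = 3 * m%:R.
  by rewrite /M sZ !natrM; field; rewrite gt_eqF.
have : c%:R * (1 - t) <= c%:R * 3 by rewrite ler_wpM2l //; move: tl; lra.
rewrite -(ler_nat R); lra.
Qed.

End Labels.

(** * Choosing homogeneous labels *)

Section Increasing.
Variable N : nat.
Implicit Types (i j k : 'I_N) (s : seq 'I_N).

Definition increasing s := sorted (fun i j => i < j) s.

Lemma increasing_subseq s s' : subseq s' s -> increasing s -> increasing s'.
Proof. by apply: subseq_sorted => j i k; apply: ltn_trans. Qed.

Lemma increasing_pairwise s : increasing s = pairwise (fun i j : 'I_N => i < j) s.
Proof. by apply: sorted_pairwise => j i k; apply: ltn_trans. Qed.

Lemma increasing_uniq s : increasing s -> uniq s.
Proof. by apply: sorted_uniq => [j i k|i]; [apply: ltn_trans | rewrite ltnn]. Qed.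

Lemma increasing_split s i j : increasing s -> i \in s -> j \in s -> i < j ->
  exists A B C, s = A ++ i :: B ++ j :: C.
Proof.
move=> + is_ js ij; case/splitPr: is_ js => A D; rewrite increasing_pairwise pairwise_cat /=.
rewrite mem_cat inE => + /and3P[/allrelP hA _ _].
have -> : (j \in A) = false.
  apply/negP => jA; have := hA j i jA (mem_head _ _).
  by rewrite ltnNge ltnW.
have -> : (j == i) = false by apply/negP => /eqP ji; rewrite ji ltnn in ij.
by move=> /= jD; case/splitPr: jD => B C; exists A, B, C.
Qed.

Lemma increasing_zones A B C i j k : increasing (A ++ i :: B ++ j :: C) ->
  k \in A ++ i :: B ++ j :: C ->
  [/\ k < i -> k \in A, i < k -> k < j -> k \in B & j < k -> k \in C].
Proof.
rewrite increasing_pairwise pairwise_cat /= pairwise_cat /= all_cat /=.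
case/and3P=> /allrelP hA _ /andP[/and3P[iB ij iC] /and3P[/allrelP hB _ /andP[/allP jC _]]].
rewrite mem_cat inE mem_cat inE => /or4P[kA|/eqP->|kB|/orP[/eqP->|kC]].
- have ki := hA k i kA (mem_head _ _).
  have kj : k < j by apply: hA => //; rewrite inE mem_cat mem_head !orbT.
  by split=> // h; lia.
- by split=> h; lia.
- have ik := allP iB k kB; have kj := hB k j kB (mem_head _ _).
  by split=> // h; lia.
- by split=> h; lia.
- have ik := allP iC k kC; have jk := jC k kC.
  by split=> // h; lia.
Qed.

End Increasing.

Section Step.
Variable R : realFieldType.
Local Open Scope ring_scope.

(* [phiL i j k x], [phiT i j k x], [phiR i j k x] measure the effect of a vertex x of V_ij on the
   triad with third index k, where k > j, i < k < j and k < i respectively. *)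
Lemma label_step (K n : nat) : (0 < K)%N -> exists M, forall (N : nat) (V : finType) (v0 : V)
    (u : 'I_N -> 'I_N -> V -> R) (phiL phiT phiR : 'I_N -> 'I_N -> 'I_N -> V -> R)
    (S : seq 'I_N), increasing S -> (M <= size S)%N ->
  (forall i j : 'I_N, (i < j)%N -> (forall x, 0 <= u i j x) /\ \sum_x u i j x = 1) ->
  (forall i j k : 'I_N, (i < j)%N -> (j < k)%N -> \sum_x u i j x * phiL i j k x = 0 /\
     forall x, `|phiL i j k x| <= 1) ->
  (forall i j k : 'I_N, (i < k)%N -> (k < j)%N -> \sum_x u i j x * phiT i j k x = 0 /\
     forall x, `|phiT i j k x| <= 1) ->
  (forall i j k : 'I_N, (k < i)%N -> (i < j)%N -> \sum_x u i j x * phiR i j k x = 0 /\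
     forall x, `|phiR i j k x| <= 1) ->
  exists (S' : seq 'I_N) (c : 'I_N -> 'I_N -> V), [/\ subseq S' S, size S' = n,
    (forall i j : 'I_N, i \in S' -> j \in S' -> (i < j)%N -> 0 < u i j (c i j)) &
    forall i j k : 'I_N, i \in S' -> j \in S' -> k \in S' -> (i < j)%N -> (j < k)%N ->
      - 6 / K%:R <= phiL i j k (c i j) + phiT i k j (c i k) + phiR j k i (c j k)].
Proof.
(* A zone of the final list has at most n other indices, hence fewer than m; M is the zone length
   for which [popular_threshold] yields m indices. *)
move=> K0; pose m := n.+1; pose M := (3 * K * m)%N.
pose Q := 'I_(4 * K).+1.
(* The coloured sublists consist of i, j and m indices in each of three zones. In the size, 3M+2
   serves the averaging and the rest the spacing. *)
have [L HL] := ramsey (option (Q * Q * Q)) ((m + m + m).+2)%N (3 * M + 2 + n.+1 * m.+1 + m)%N.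
exists L => N V v0 u phiL phiT phiR S incS LS hu hL hT hR.
have [Sn|Sn] := eqVneq S [::].
  have [S1 [l0 [S1S sS1 _]]] := HL _ (fun=> None) S LS.
  by move: S1S sS1; rewrite Sn subseq0 => /eqP -> /=; lia.
have [s0 _] : exists s0, s0 \in S by case: S Sn {incS LS} => // s S _; exists s; rewrite mem_head.
(* Some x in V_ij exceeds fixed thresholds on many k in each of the three zones; colouring the
   sublists K1 ++ i :: K2 ++ j :: K3 by the thresholds makes them independent of i and j. *)
pose good (i j : 'I_N) (K1 K2 K3 : seq 'I_N) (l : Q * Q * Q) (x : V) :=
  [&& 0 < u i j x, all (fun k => grid R K l.1.1 <= phiR i j k x) K1,
      all (fun k => grid R K l.1.2 <= phiT i j k x) K2 &
      all (fun k => grid R K l.2 <= phiL i j k x) K3].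
pose balanced (l : Q * Q * Q) :=
  - 6 / K%:R <= grid R K l.1.1 + grid R K l.1.2 + grid R K l.2.
pose chi (t : seq 'I_N) := [pick l | balanced l &&
  [exists x, good (nth s0 t m) (nth s0 t (m + m.+1)) (take m t) (take m (drop m.+1 t))
                  (drop (m + m.+2) t) l x]].
have chiE i j K1 K2 K3 : size K1 = m -> size K2 = m ->
    chi (K1 ++ i :: K2 ++ j :: K3) =
    [pick l | balanced l && [exists x, good i j K1 K2 K3 l x]].
  move=> s1 s2; rewrite /chi nth_cat s1 ltnn subnn /= take_size_cat //.
  rewrite nth_cat s1 ltnNge leq_addr addKn /= nth_cat s2 ltnn subnn /=.
  rewrite !drop_cat s1 !ltnNge leqnSn leq_addr !addKn subSnn /= drop0 take_size_cat //.
  by rewrite drop_cat s2 ltnNge leqnSn subSnn /= drop0.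
have [S1 [l0 [S1S sS1 hom]]] := HL _ chi S LS.
have incS1 := increasing_subseq S1S incS.
(* The common colour is not [None]: averaging around one pair i, j produces a sublist with balanced
   thresholds and a good vertex. *)
have [l [l0E lbal]] : exists l, l0 = Some l /\ balanced l.
  have sM : (3 * M + 2 <= size S1)%N by rewrite sS1 -addnA leq_addr.
  have [Z1 [i [Z2 [j [Z3 [S1E sZ1 sZ2 sZ3]]]]]] : exists Z1 i Z2 j Z3,
      [/\ S1 = Z1 ++ i :: Z2 ++ j :: Z3, size Z1 = M, size Z2 = M & M <= size Z3]%N.
    exists (take M S1), (nth s0 S1 M), (take M (drop M.+1 S1)), (nth s0 (drop M.+1 S1) M).
    exists (drop M.+1 (drop M.+1 S1)); split.
    - rewrite -drop_nth ?cat_take_drop; last by rewrite size_drop; lia.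
      by rewrite -drop_nth ?cat_take_drop //; lia.
    - by rewrite size_takel //; lia.
    - by rewrite size_takel // size_drop; lia.
    - by rewrite !size_drop; lia.
  have := incS1; rewrite S1E => inc.
  have zones k := increasing_zones (k := k) inc.
  move: (inc); rewrite increasing_pairwise pairwise_cat /= pairwise_cat /= all_cat /=.
  case/and3P=> /allrelP hA _ /andP[/and3P[iB ij iC] /and3P[/allrelP hB _ /andP[/allP jC _]]].
  have [u0 u1] := hu _ _ ij.
  pose Z := take M Z3; have sZ : size Z = M by rewrite size_takel.
  have ZZ3 : {subset Z <= Z3} by apply: mem_take.
  have L1 k : k \in Z -> \sum_x u i j x * phiL i j k x = 0 /\ forall x, `|phiL i j k x| <= 1.
    by move=> /ZZ3/jC jk; apply: hL.
  have L2 k : k \in Z2 -> \sum_x u i j x * phiT i j k x = 0 /\ forall x, `|phiT i j k x| <= 1.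
    by move=> kZ; apply: hT; [apply: (allP iB) | apply: hB; rewrite ?mem_head].
  have L3 k : k \in Z1 -> \sum_x u i j x * phiR i j k x = 0 /\ forall x, `|phiR i j k x| <= 1.
    by move=> kZ; apply: hR => //; apply: hA; rewrite ?mem_head.
  (* The total first-order effect of x over the three zones, of mean zero under [u i j]. *)
  pose F x := \sum_(k <- Z1) phiR i j k x + \sum_(k <- Z2) phiT i j k x +
              \sum_(k <- Z) phiL i j k x.
  have uF : \sum_x u i j x * F x = 0.
    have z0 (Y : seq 'I_N) (phi : 'I_N -> V -> R) :
        (forall k, k \in Y -> \sum_x u i j x * phi k x = 0) ->
        \sum_x u i j x * \sum_(k <- Y) phi k x = 0.
      move=> h; under eq_bigr do rewrite mulr_sumr.
      by rewrite exchange_big big_seq big1.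
    under eq_bigr do rewrite !mulrDr.
    rewrite !big_split /= !z0 ?addr0 // => k kZ.
    - by have [] := L1 k kZ.
    - by have [] := L2 k kZ.
    - by have [] := L3 k kZ.
  have [x x0 Fx] := mean_witness u0 u1 uF.
  have m0 : (0 < m)%N by [].
  have [q1 [b1 c1]] := popular_threshold (f := fun k => phiR i j k x) K0 m0 sZ1
    (fun k kZ => (L3 k kZ).2 x).
  have [q2 [b2 c2]] := popular_threshold (f := fun k => phiT i j k x) K0 m0 sZ2
    (fun k kZ => (L2 k kZ).2 x).
  have [q3 [b3 c3]] := popular_threshold (f := fun k => phiL i j k x) K0 m0 sZ
    (fun k kZ => (L1 k kZ).2 x).
  have bal : balanced (q1, q2, q3).
    rewrite /balanced /=; move: b1 b2 b3; rewrite sZ1 sZ2 sZ => b1 b2 b3.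
    have Mp : 0 < M%:R :> R by rewrite ltr0n !muln_gt0 K0 m0.
    rewrite -(ler_pM2r Mp); move: Fx; rewrite /F => Fx.
    have : 0 <= (grid R K q1 + 2 / K%:R) * M%:R + (grid R K q2 + 2 / K%:R) * M%:R +
        (grid R K q3 + 2 / K%:R) * M%:R by move: b1 b2 b3 Fx; lra.
    rewrite -!mulrDl => h.
    have : 0 <= (grid R K q1 + grid R K q2 + grid R K q3 + 6 / K%:R) * M%:R.
      by apply: le_trans h _; rewrite ler_wpM2r ?ler0n //; lra.
    by rewrite mulrDl; lra.
  have pick_zone (Y : seq 'I_N) (phi : 'I_N -> V -> R) (q : Q) :
      (m <= count (fun k => (grid R K q <= phi k x)%R) Y)%N ->
      exists K', [/\ subseq K' Y, size K' = m & all (fun k => grid R K q <= phi k x) K'].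
    rewrite -size_filter => mY; exists (take m (filter (fun k => grid R K q <= phi k x) Y)); split.
    - exact: subseq_trans (take_subseq _ _) (filter_subseq _ _).
    - by rewrite size_takel.
    - by apply/allP => k /mem_take; rewrite mem_filter => /andP[].
  have [K1 [KZ1 sK1 g1]] := pick_zone _ _ _ c1.
  have [K2 [KZ2 sK2 g2]] := pick_zone _ _ _ c2.
  have [K3 [KZ3 sK3 g3]] := pick_zone _ _ _ c3.
  have tS1 : subseq (K1 ++ i :: K2 ++ j :: K3) S1.
    rewrite S1E cat_subseq //= eqxx cat_subseq //= eqxx.
    exact: subseq_trans KZ3 (take_subseq _ _).
  have st : size (K1 ++ i :: K2 ++ j :: K3) = ((m + m + m).+2)%N.
    by rewrite size_cat /= size_cat /= sK1 sK2 sK3; clear; move: m => m0; lia.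
  have hl0 := hom _ tS1 st.
  rewrite chiE // in hl0.
  rewrite -hl0.
  case: pickP => [l /andP[lb _]|no]; first by exists l; split.
  have := no (q1, q2, q3); rewrite bal andTb => /existsP[].
  by exists x; apply/and4P; split.
(* For any pair in [S'] each zone can now be padded to m indices inside [S1]; a vertex good for the
   padded zones is good for the zones of [S']. *)
have [S' [S'S1 sS' one two]] : exists S', [/\ subseq S' S1, size S' = n,
    forall A i C, S' = A ++ i :: C -> exists Z1 Z3, [/\ S1 = Z1 ++ i :: Z3,
      subseq A Z1, subseq C Z3, m <= size Z1 & m <= size Z3]%N &
    forall A i B j C, S' = A ++ i :: B ++ j :: C ->
      exists Z1 Z2 Z3, [/\ S1 = Z1 ++ i :: Z2 ++ j :: Z3,
        [/\ subseq A Z1, subseq B Z2 & subseq C Z3] &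
        [/\ m <= size Z1, m <= size Z2 & m <= size Z3]%N]].
  by apply: spaced_subseq; rewrite sS1 /m; lia.
have incS' := increasing_subseq S'S1 incS1.
pose lab i j x := [&& 0 < u i j x,
  all (fun k : 'I_N => (k < i)%N ==> (grid R K l.1.1 <= phiR i j k x)) S',
  all (fun k : 'I_N => (i < k < j)%N ==> (grid R K l.1.2 <= phiT i j k x)) S' &
  all (fun k : 'I_N => (j < k)%N ==> (grid R K l.2 <= phiL i j k x)) S'].
pose c i j := odflt v0 [pick x | lab i j x].
have clab i j : i \in S' -> j \in S' -> (i < j)%N -> lab i j (c i j).
  move=> iS jS ij; rewrite /c; case: pickP => [//|no].
  have [A [B [C S'E]]] := increasing_split incS' iS jS ij.
  have [Z1 [Z2 [Z3 [S1E [AZ BZ CZ] [m1 m2 m3]]]]] := two _ _ _ _ _ S'E.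
  have [sA sB sC] : [/\ size A <= m, size B <= m & size C <= m]%N.
    have : size S' = n by [].
    rewrite S'E /m size_cat /= size_cat /=.
    by move: (size A) (size B) (size C); clear => a b c abc; split; lia.
  have [|K1 [AK KZ1 sK1]] := subseq_pad (m := m) AZ; first by rewrite sA m1.
  have [|K2 [BK KZ2 sK2]] := subseq_pad (m := m) BZ; first by rewrite sB m2.
  have [|K3 [CK KZ3 sK3]] := subseq_pad (m := m) CZ; first by rewrite sC m3.
  have := hom (K1 ++ i :: K2 ++ j :: K3).
  rewrite S1E l0E chiE // => hom1.
  have {hom1} : [pick l | balanced l && [exists x, good i j K1 K2 K3 l x]] = Some l.
    apply: hom1.
      by rewrite cat_subseq //= eqxx cat_subseq //= eqxx.
    by rewrite size_cat /= size_cat /= sK1 sK2 sK3; clear; move: m => m0; lia.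
  case: pickP => // l' /andP[_ /existsP[x /and4P[x0 g1 g2 g3]]] [l'l]; subst l'.
  have zones k : k \in S' -> [/\ (k < i)%N -> k \in A, (i < k)%N -> (k < j)%N -> k \in B &
      (j < k)%N -> k \in C].
    by move=> kS; apply: increasing_zones; rewrite -S'E.
  have := no x; rewrite /lab x0 /=; case/and3P; split; apply/allP => k /zones[zA zB zC].
  - by apply/implyP => /zA/(mem_subseq AK)/(allP g1).
  - by apply/implyP => /andP[h1 h2]; apply: (allP g2); apply: (mem_subseq BK); apply: zB.
  - by apply/implyP => /zC/(mem_subseq CK)/(allP g3).
exists S', c; split=> //; first exact: subseq_trans S'S1 S1S.
  by move=> i j iS jS ij; have /and4P[] := clab i j iS jS ij.
move=> i j k iS jS kS ij jk; have ik := ltn_trans ij jk.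
(* Relative to the pairs ij, ik and jk the third index lies above, between and below respectively,
   so the three thresholds of l add up. *)
have /and4P[_ _ _ /allP/(_ k kS)] := clab i j iS jS ij; rewrite jk /= => hLk.
have /and4P[_ _ /allP/(_ j jS) + _] := clab i k iS kS ik; rewrite ij jk /= => hTk.
have /and4P[_ /allP/(_ i iS) + _ _] := clab j k jS kS jk; rewrite ij /= => hRk.
by apply: le_trans lbal _; lra.
Qed.
End Step.

Local Open Scope ring_scope.

(** * Trilinear densities and their first-order change *)

Section Trilinear.
Variables (R : realFieldType) (V : finType) (e : V -> V -> V -> bool).
Implicit Types f g h : V -> R.

Definition tri f g h : R := \sum_x \sum_y \sum_z f x * g y * h z * (e x y z)%:R.

Lemma eq_tri f f' g g' h h' : f =1 f' -> g =1 g' -> h =1 h' -> tri f g h = tri f' g' h'.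
Proof.
move=> ef eg eh; apply: eq_bigr => x _; apply: eq_bigr => y _; apply: eq_bigr => z _.
by rewrite ef eg eh.
Qed.

Lemma tri_lin1 a f f' g h : tri (fun x => f x + a * f' x) g h = tri f g h + a * tri f' g h.
Proof.
rewrite /tri mulr_sumr -big_split; apply: eq_bigr => x _ /=.
rewrite mulr_sumr -big_split; apply: eq_bigr => y _ /=.
by rewrite mulr_sumr -big_split; apply: eq_bigr => z _ /=; ring.
Qed.

Lemma tri_lin2 a f g g' h : tri f (fun x => g x + a * g' x) h = tri f g h + a * tri f g' h.
Proof.
rewrite /tri mulr_sumr -big_split; apply: eq_bigr => x _ /=.
rewrite mulr_sumr -big_split; apply: eq_bigr => y _ /=.
by rewrite mulr_sumr -big_split; apply: eq_bigr => z _ /=; ring.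
Qed.

Lemma tri_lin3 a f g h h' : tri f g (fun x => h x + a * h' x) = tri f g h + a * tri f g h'.
Proof.
rewrite /tri mulr_sumr -big_split; apply: eq_bigr => x _ /=.
rewrite mulr_sumr -big_split; apply: eq_bigr => y _ /=.
by rewrite mulr_sumr -big_split; apply: eq_bigr => z _ /=; ring.
Qed.

Definition subprob f := (forall x, 0 <= f x) /\ \sum_x f x <= 1.

Lemma tri_ge0 f g h : (forall x, 0 <= f x) -> (forall x, 0 <= g x) -> (forall x, 0 <= h x) ->
  0 <= tri f g h.
Proof. by move=> f0 g0 h0; do 3 (apply: sumr_ge0 => ? _); rewrite !mulr_ge0. Qed.

Lemma tri_le1 f g h : subprob f -> subprob g -> subprob h -> tri f g h <= 1.
Proof.
move=> [f0 f1] [g0 g1] [h0 h1].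
apply: le_trans (_ : (\sum_x f x) * ((\sum_x g x) * (\sum_x h x)) <= 1).
  rewrite mulr_suml; apply: ler_sum => x _; rewrite mulr_suml mulr_sumr; apply: ler_sum => y _.
  rewrite !mulr_sumr; apply: ler_sum => z _; rewrite mulrA.
  by rewrite ler_piMr ?mulr_ge0 // lern1 leq_b1.
by rewrite !mulr_ile1 ?mulr_ge0 ?sumr_ge0.
Qed.

Definition delta c (x : V) : R := (x == c)%:R.

Lemma delta_subprob c : subprob (delta c).
Proof.
split=> [x|]; first by rewrite /delta ler0n.
rewrite /delta (bigD1 c) //= eqxx big1 ?addr0 // => x /negbTE -> //.
Qed.

Lemma sum_deltaM c (F : V -> R) : \sum_x delta c x * F x = F c.
Proof.
rewrite (bigD1 c) //= /delta eqxx mul1r big1 ?addr0 // => x /negbTE ->.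
by rewrite mul0r.
Qed.

(** Averaging one argument over point masses shows that replacing it by a random point mass has mean
    effect zero, as [label_step] requires. *)
Lemma tri_avg1 f g h : tri f g h = \sum_x f x * tri (delta x) g h.
Proof.
apply: eq_bigr => x _; rewrite /tri.
under [in RHS]eq_bigr => x' _ do under eq_bigr => y _ do under eq_bigr => z _ do rewrite -!mulrA.
under [in RHS]eq_bigr => x' _ do under eq_bigr => y _ do rewrite -mulr_sumr.
under [in RHS]eq_bigr => x' _ do rewrite -mulr_sumr.
rewrite sum_deltaM mulr_sumr; apply: eq_bigr => y _; rewrite mulr_sumr; apply: eq_bigr => z _.
by rewrite !mulrA.
Qed.

Lemma tri_avg2 f g h : tri f g h = \sum_y g y * tri f (delta y) h.
Proof.
rewrite /tri exchange_big; apply: eq_bigr => y _ /=.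
under [in RHS]eq_bigr => x _ do under eq_bigr => y' _ do under eq_bigr => z _ do
  rewrite (mulrC (f x)) -!mulrA.
under [in RHS]eq_bigr => x _ do under eq_bigr => y' _ do rewrite -mulr_sumr.
under [in RHS]eq_bigr => x _ do rewrite sum_deltaM.
rewrite mulr_sumr; apply: eq_bigr => x _; rewrite mulr_sumr; apply: eq_bigr => z _.
by rewrite !mulrA (mulrC (g y)).
Qed.

Lemma tri_avg3 f g h : tri f g h = \sum_z h z * tri f g (delta z).
Proof.
rewrite /tri; under eq_bigr do rewrite exchange_big; rewrite exchange_big /=.
apply: eq_bigr => z _; rewrite mulr_sumr; apply: eq_bigr => x _; rewrite mulr_sumr.
apply: eq_bigr => y _.
under [in RHS]eq_bigr => z' _ do rewrite mulrAC (mulrC _ (delta z z')).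
by rewrite sum_deltaM; ring.
Qed.

(** Expand both sides: the constant terms agree and the first-order terms lose at most tb. The
    higher terms in the u's sum to at most 3t^2 + t^3, hence 4t^2, and those in the point masses are
    nonnegative. *)
Lemma tri_perturb (t b : R) a1 a2 a3 u1 u2 u3 c1 c2 c3 : 0 <= t -> t <= 1 ->
  subprob a1 -> subprob a2 -> subprob a3 -> subprob u1 -> subprob u2 -> subprob u3 ->
  - b <= (tri (delta c1) a2 a3 - tri u1 a2 a3) + (tri a1 (delta c2) a3 - tri a1 u2 a3) +
      (tri a1 a2 (delta c3) - tri a1 a2 u3) ->
  tri (fun x => a1 x + t * u1 x) (fun x => a2 x + t * u2 x) (fun x => a3 x + t * u3 x)
    - t * b - 4 * t ^+ 2 <=
  tri (fun x => a1 x + t * delta c1 x) (fun x => a2 x + t * delta c2 x)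
      (fun x => a3 x + t * delta c3 x).
Proof.
move=> t0 t1 A1 A2 A3 U1 U2 U3 hb.
have ex v1 v2 v3 :
  tri (fun x => a1 x + t * v1 x) (fun x => a2 x + t * v2 x) (fun x => a3 x + t * v3 x) =
  tri a1 a2 a3 + t * (tri v1 a2 a3 + tri a1 v2 a3 + tri a1 a2 v3) +
  t ^+ 2 * (tri v1 v2 a3 + tri v1 a2 v3 + tri a1 v2 v3) + t ^+ 3 * tri v1 v2 v3.
  by rewrite tri_lin1 !tri_lin2 !tri_lin3; ring.
rewrite !ex.
have D c := delta_subprob c.
have t2 : 0 <= t ^+ 2 by rewrite exprn_ge0.
have t3 : 0 <= t ^+ 3 by rewrite exprn_ge0.
have t32 : t ^+ 3 <= t ^+ 2 by rewrite exprS ler_piMl.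
have P f g h : subprob f -> subprob g -> subprob h -> 0 <= tri f g h <= 1.
  by move=> F G H; rewrite tri_le1 // tri_ge0 //; [case: F|case: G|case: H].
have h1 : t ^+ 2 * (tri u1 u2 a3 + tri u1 a2 u3 + tri a1 u2 u3) <= t ^+ 2 * 3.
  rewrite ler_wpM2l //; have := P _ _ _ U1 U2 A3; have := P _ _ _ U1 A2 U3.
  by have := P _ _ _ A1 U2 U3; lra.
have h2 : t ^+ 3 * tri u1 u2 u3 <= t ^+ 2.
  by apply: le_trans t32; rewrite ler_piMr //; have /andP[] := P _ _ _ U1 U2 U3.
have h3 : 0 <= t ^+ 2 * (tri (delta c1) (delta c2) a3 + tri (delta c1) a2 (delta c3) +
    tri a1 (delta c2) (delta c3)).
  rewrite mulr_ge0 //; have := P _ _ _ (D c1) (D c2) A3; have := P _ _ _ (D c1) A2 (D c3).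
  by have := P _ _ _ A1 (D c2) (D c3); lra.
have h4 : 0 <= t ^+ 3 * tri (delta c1) (delta c2) (delta c3).
  by rewrite mulr_ge0 //; have /andP[] := P _ _ _ (D c1) (D c2) (D c3).
have h5 := ler_wpM2l t0 hb.
have : t * (tri u1 a2 a3 + tri a1 u2 a3 + tri a1 a2 u3) - t * b <=
   t * (tri (delta c1) a2 a3 + tri a1 (delta c2) a3 + tri a1 a2 (delta c3)).
  by move: h5; rewrite mulrN !mulrDr !mulrN; lra.
lra.
Qed.

End Trilinear.

(** * Replacing the uniform measures by labels *)

Section Iterate.
Variables (R : realFieldType) (K : nat).
Hypothesis K0 : (0 < K)%N.
Local Notation th := (K%:R^-1 : R).

Definition prob (V : finType) (f : V -> R) := (forall x, 0 <= f x) /\ \sum_x f x = 1.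

Lemma prob_subprob (V : finType) (f : V -> R) : prob f -> subprob f.
Proof. by case=> f0 f1; split=> //; rewrite f1. Qed.

(* For s = t this is the measure after t labels; s = t + 1 leaves out the mass 1/K that the next
   label will receive. *)
Definition mix (V : finType) (u : V -> R) (c : nat -> V) (s t : nat) (x : V) : R :=
  (1 - s%:R * th) * u x + th * \sum_(al < t) delta R (c al) x.

Lemma mix_subprob (V : finType) (u : V -> R) c s t : prob u -> (t <= s)%N -> (s <= K)%N ->
  subprob (mix u c s t).
Proof.
move=> [u0 u1] ts sK.
have Kp : 0 < K%:R :> R by rewrite ltr0n.
have th0 : 0 <= th by rewrite invr_ge0 ltW.
have sth : s%:R * th <= 1 by rewrite ler_pdivrMr // mul1r ler_nat.
split=> [x|].
  apply: addr_ge0; apply: mulr_ge0 => //; first by rewrite subr_ge0.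
  by apply: sumr_ge0 => al _; case: (delta_subprob R (c al)).
rewrite /mix big_split /= -!mulr_sumr u1 exchange_big /=.
have -> : \sum_(al < t) \sum_x delta R (c al) x = t%:R.
  under eq_bigr => al _.
    have -> : \sum_x delta R (c al) x = 1.
      by rewrite -[RHS](sum_deltaM (R := R) (c al) (fun=> 1)); apply: eq_bigr => x _; rewrite mulr1.
    over.
  by rewrite sumr_const card_ord.
have : t%:R * th <= s%:R * th by rewrite ler_wpM2r // ler_nat.
by rewrite mulr1 mulrC; lra.
Qed.

(** Each new label costs 6/K^2 through the error of [label_step] and 4/K^2 through the higher-order
    terms of [tri_perturb], hence 10/K^2. *)
Lemma labels_iter (n t : nat) : (t <= K)%N ->
  exists M, forall (N : nat) (V : finType) (v0 : V) (u : 'I_N -> 'I_N -> V -> R)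
    (e : V -> V -> V -> bool) (D : R) (S : seq 'I_N), increasing S -> (M <= size S)%N ->
  (forall i j : 'I_N, (i < j)%N -> prob (u i j)) ->
  (forall i j k : 'I_N, i \in S -> j \in S -> k \in S -> (i < j)%N -> (j < k)%N ->
     D <= tri e (u i j) (u i k) (u j k)) ->
  exists (S' : seq 'I_N) (c : 'I_N -> 'I_N -> nat -> V), [/\ subseq S' S, size S' = n,
    (forall al (i j : 'I_N), (al < t)%N -> i \in S' -> j \in S' -> (i < j)%N -> 0 < u i j (c i j al)) &
    forall i j k : 'I_N, i \in S' -> j \in S' -> k \in S' -> (i < j)%N -> (j < k)%N ->
      D - 10 * t%:R * th ^+ 2 <= tri e (mix (u i j) (c i j) t t) (mix (u i k) (c i k) t t)
             (mix (u j k) (c j k) t t)].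
Proof.
have Kp : 0 < K%:R :> R by rewrite ltr0n.
have th0 : 0 <= th by rewrite invr_ge0 ltW.
have th1 : th <= 1 by rewrite invf_le1 // ler1n.
elim: t n => [|t IH] n tK.
  exists n => N V v0 u e D S incS nS hu hD; exists (take n S), (fun _ _ _ => v0).
  have sub : subseq (take n S) S by apply: take_subseq.
  split=> // [|i j k /(mem_subseq sub) iS /(mem_subseq sub) jS /(mem_subseq sub) kS ij jk].
    by rewrite size_takel.
  have m0 (i' j' : 'I_N) : u i' j' =1 mix (u i' j') (fun=> v0) 0 0.
    by move=> x; rewrite /mix big_ord0 mul0r subr0 mul1r mulr0 addr0.
  rewrite mulr0 mul0r subr0 -(eq_tri e (m0 i j) (m0 i k) (m0 j k)).
  exact: hD.
have [M1 H1] := label_step R n K0; have [M HM] := IH M1 (ltnW tK).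
exists M => N V v0 u e D S incS MS hu hD.
have [S1 [c1 [S1S sS1 pos1 dens1]]] := HM N V v0 u e D S incS MS hu hD.
have incS1 := increasing_subseq S1S incS.
(* The old and new measures are [a] plus mass 1/K placed on [u], respectively on the new label. *)
pose a i j := mix (u i j) (c1 i j) t.+1 t.
have A (i j : 'I_N) : (i < j)%N -> subprob (a i j) by move=> ij; apply: mix_subprob => //; apply: hu.
have U (i j : 'I_N) : (i < j)%N -> subprob (u i j) by move=> ij; apply/prob_subprob/hu.
have Dl c := delta_subprob R (c : V).
pose phiL i j k x := tri e (delta R x) (a i k) (a j k) - tri e (u i j) (a i k) (a j k).
pose phiT i j k x := tri e (a i k) (delta R x) (a k j) - tri e (a i k) (u i j) (a k j).
pose phiR i j k x := tri e (a k i) (a k j) (delta R x) - tri e (a k i) (a k j) (u i j).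
have P f g h : subprob f -> subprob g -> subprob h -> 0 <= tri e f g h <= 1.
  by move=> F G H; rewrite tri_le1 // tri_ge0 //; [case: F|case: G|case: H].
have dif (x y : R) : 0 <= x <= 1 -> 0 <= y <= 1 -> `|x - y| <= 1.
  by move=> hx hy; rewrite ler_norml; lra.
have zero (i j : 'I_N) (F : V -> R) (m : R) : (i < j)%N -> m = \sum_x u i j x * F x ->
    \sum_x u i j x * (F x - m) = 0.
  move=> /hu[_ u1] mE; under eq_bigr do rewrite mulrBr.
  by rewrite big_split /= sumrN -mulr_suml u1 mul1r -mE subrr.
have [||||S' [c' [S'S1 sS' pos' lab']]] := H1 N V v0 u phiL phiT phiR S1 incS1 (eq_leq (esym sS1)).
- by [].
- move=> i j k ij jk; have ik := ltn_trans ij jk; split=> [|x].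
    by apply: zero => //; apply: tri_avg1.
  by apply: dif; apply: P; auto.
- move=> i j k ik kj; have ij := ltn_trans ik kj; split=> [|x].
    by apply: zero => //; apply: tri_avg2.
  by apply: dif; apply: P; auto.
- move=> i j k ki ij; have kj := ltn_trans ki ij; split=> [|x].
    by apply: zero => //; apply: tri_avg3.
  by apply: dif; apply: P; auto.
pose c i j al := if al == t then c' i j else c1 i j al.
exists S', c; split=> //; first exact: subseq_trans S'S1 S1S.
  move=> al i j; rewrite ltnS leq_eqVlt /c; case: eqP => [_ _|_ /= alt] iS jS ij.
    exact: pos'.
  by apply: pos1 => //; apply: (mem_subseq S'S1).
move=> i j k iS jS kS ij jk; have ik := ltn_trans ij jk.
have mixS (i' j' : 'I_N) : mix (u i' j') (c i' j') t.+1 t.+1 =1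
    (fun x => a i' j' x + th * delta R (c' i' j') x).
  move=> x; rewrite /mix big_ord_recr /= {2}/c eqxx mulrDr addrA; congr (_ + _ * _ + _).
  by apply: eq_bigr => al _; rewrite /c ltn_eqF.
have mixt (i' j' : 'I_N) : mix (u i' j') (c1 i' j') t t =1 (fun x => a i' j' x + th * u i' j' x).
  by move=> x; rewrite /a /mix -natr1; ring.
rewrite (eq_tri e (mixS i j) (mixS i k) (mixS j k)).
have b : - (6 * th) <= phiL i j k (c' i j) + phiT i k j (c' i k) + phiR j k i (c' j k).
  by rewrite -mulNr; apply: lab'.
apply: le_trans (tri_perturb th0 th1 (A _ _ ij) (A _ _ ik) (A _ _ jk) (U _ _ ij) (U _ _ ik)
  (U _ _ jk) b).
have := dens1 i j k (mem_subseq S'S1 iS) (mem_subseq S'S1 jS) (mem_subseq S'S1 kS) ij jk.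
rewrite (eq_tri e (mixt i j) (mixt i k) (mixt j k)) -natr1 expr2.
set X := tri _ _ _ _; clearbody X; clear; lra.
Qed.

End Iterate.

(** * From a partitioned hypergraph to a palette *)

Section Host.
Variables (R : realType) (N : nat) (V : finType) (p : V -> 'I_N * 'I_N) (E : {set {set V}}).
Hypothesis hH : partitioned_hypergraph p E.

Definition uniform (i j : 'I_N) (x : V) : R := (inpart p i j x)%:R / #|part p i j|%:R.

Definition edge (x y z : V) : bool := [set x; y; z] \in E.

Lemma part_gt0 (i j : 'I_N) : (i < j)%N -> (0 < #|part p i j|)%N.
Proof.
case: hH => _ h _ ij; have [v vE] := h i j ij; rewrite card_gt0; apply/set0Pn; exists v.
by rewrite inE /inpart vE eqxx.
Qed.

Lemma uniform_prob (i j : 'I_N) : (i < j)%N -> prob (uniform i j).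
Proof.
move=> ij; split=> [x|]; first by rewrite divr_ge0.
rewrite -mulr_suml -natr_sum; have -> : (\sum_x inpart p i j x)%N = #|part p i j|.
  by rewrite -sum1_card -big_mkcond; apply: eq_bigl => x; rewrite inE.
by rewrite divff // pnatr_eq0 -lt0n part_gt0.
Qed.

Lemma inpart_disjoint (i j i' j' : 'I_N) x : (i < j)%N -> (i' < j')%N -> inpart p i j x ->
  inpart p i' j' x -> i = i' /\ j = j'.
Proof.
rewrite /inpart => ij ij' /orP[] /eqP -> /orP[] /eqP [e1 e2]; subst=> //; lia.
Qed.

(** An edge of the triad meets the three pairwise disjoint parts in one vertex each; these are
    distinct and fill the edge, so it is the image of an ordered triple. *)
Lemma triad_card (i j k : 'I_N) : (i < j)%N -> (j < k)%N ->
  (#|triad p E i j k| <= \sum_x \sum_y \sum_z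
     [&& inpart p i j x, inpart p i k y, inpart p j k z & edge x y z])%N.
Proof.
move=> ij jk; have ik := ltn_trans ij jk.
pose T := [set t : V * (V * V) | [&& inpart p i j t.1, inpart p i k t.2.1,
  inpart p j k t.2.2 & edge t.1 t.2.1 t.2.2]].
have -> : (\sum_x \sum_y \sum_z
     [&& inpart p i j x, inpart p i k y, inpart p j k z & edge x y z])%N = #|T|.
  pose F x y z : nat := [&& inpart p i j x, inpart p i k y, inpart p j k z & edge x y z].
  rewrite -sum1_card [RHS]big_mkcond /=.
  transitivity (\sum_(t : V * (V * V)) F t.1 t.2.1 t.2.2)%N; last first.
    by apply: eq_bigr => t _; rewrite inE /F; case: (_ && _).
  rewrite -(pair_bigA _ (fun x t => F x t.1 t.2)) /=; apply: eq_bigr => x _.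
  by rewrite -(pair_bigA _ (fun y z => F x y z)).
apply: leq_trans (leq_imset_card (fun t : V * (V * V) => [set t.1; t.2.1; t.2.2]) T).
apply: subset_leq_card; apply/subsetP => s; rewrite inE => /andP[sE].
case/and4P=> /cards1P[x xE] /cards1P[y yE] /cards1P[z zE] /eqP s3.
have [xs xp] : x \in s /\ inpart p i j x.
  by have := set11 x; rewrite -xE !inE => /andP[].
have [ys yp] : y \in s /\ inpart p i k y.
  by have := set11 y; rewrite -yE !inE => /andP[].
have [zs zp] : z \in s /\ inpart p j k z.
  by have := set11 z; rewrite -zE !inE => /andP[].
have xy : x != y.
  by apply/eqP => xy; subst y; have [_ ?] := inpart_disjoint ij ik xp yp; subst; rewrite ltnn in jk.
have xz : x != z.
  by apply/eqP => xz; subst z; have [? _] := inpart_disjoint ij jk xp zp; subst; rewrite ltnn in ij.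
have yz : y != z.
  by apply/eqP => yz; subst z; have [? _] := inpart_disjoint ik jk yp zp; subst; rewrite ltnn in ij.
have sxyz : [set x; y; z] = s.
  apply/eqP; rewrite eqEcard s3; apply/andP; split.
    by apply/subsetP => v; rewrite !inE => /orP[/orP[]|] /eqP ->.
  by rewrite setUC cardsU1 cards2 !inE xy negb_or ![z == _]eq_sym xz yz.
apply/imsetP; exists (x, (y, z)); last by rewrite /= sxyz.
by rewrite inE /= xp yp zp /edge sxyz.
Qed.

Lemma triad_density_le (i j k : 'I_N) : (i < j)%N -> (j < k)%N ->
  triad_density R p E i j k <= tri edge (uniform i j) (uniform i k) (uniform j k).
Proof.
move=> ij jk; have ik := ltn_trans ij jk.
rewrite /triad_density /tri.
have -> : \sum_x \sum_y \sum_z uniform i j x * uniform i k y * uniform j k z * (edge x y z)%:R =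
   (\sum_x \sum_y \sum_z [&& inpart p i j x, inpart p i k y, inpart p j k z & edge x y z])%:R
   / (#|part p i j| * #|part p i k| * #|part p j k|)%:R.
  rewrite natr_sum mulr_suml; apply: eq_bigr => x _.
  rewrite natr_sum mulr_suml; apply: eq_bigr => y _.
  rewrite natr_sum mulr_suml; apply: eq_bigr => z _.
  rewrite /uniform !natrM !invfM; case: (inpart p i j x); rewrite ?mul0r //.
  case: (inpart p i k y); rewrite ?mul0r ?mulr0 ?mul0r //.
  case: (inpart p j k z); rewrite ?mul0r ?mulr0 ?mul0r //=.
  by ring.
by rewrite ler_wpM2r ?invr_ge0 // ler_nat triad_card.
Qed.

End Host.

(** For t = 1/K the measures are the empirical distributions of K labels, so the density is the
    proportion of label triples that form edges. *)
Lemma tri_labels (R : realFieldType) (V : finType) (e : V -> V -> V -> bool) (K : nat) (t : R)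
    (c1 c2 c3 : nat -> V) :
  let f (c : nat -> V) x := t * \sum_(al < K) delta R (c al) x in
  tri e (f c1) (f c2) (f c3) =
  t ^+ 3 * weight (fun a b d : 'I_K => e (c1 a) (c2 b) (c3 d)) (fun=> 1).
Proof.
move=> f.
have sumf c (F : V -> R) : \sum_x f c x * F x = t * \sum_(al < K) F (c al).
  rewrite /f; under eq_bigr do rewrite -mulrA mulr_suml.
  rewrite -mulr_sumr exchange_big; congr (_ * _); apply: eq_bigr => al _.
  exact: sum_deltaM.
transitivity (\sum_x f c1 x * \sum_y f c2 y * \sum_z f c3 z * (e x y z)%:R).
  apply: eq_bigr => x _; rewrite mulr_sumr; apply: eq_bigr => y _.
  by rewrite mulrA mulr_sumr; apply: eq_bigr => z _; rewrite mulrA.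
rewrite sumf !exprS expr0 mulr1 -!mulrA; congr (_ * _).
under eq_bigr do rewrite sumf; rewrite -mulr_sumr; congr (_ * _).
under eq_bigr do under eq_bigr do rewrite sumf.
rewrite mulr_sumr; apply: eq_bigr => a _; rewrite mulr_sumr; apply: eq_bigr => b _.
by congr (_ * _); apply: eq_bigr => d _; rewrite !mulr1.
Qed.

Lemma increasing_subseq3 N (S : seq 'I_N) (i j k : 'I_N) : increasing S ->
  i \in S -> j \in S -> k \in S -> (i < j)%N -> (j < k)%N -> subseq [:: i; j; k] S.
Proof.
move=> incS iS jS kS ij jk.
have [A [B [C SE]]] := increasing_split incS iS jS ij; move: incS kS; rewrite SE => incS kS.
have [_ _ kC] := increasing_zones incS kS.
rewrite -[[:: i; j; k]]cat0s cat_subseq ?sub0seq //= eqxx.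
by rewrite -[[:: j; k]]cat0s cat_subseq ?sub0seq //= eqxx sub1seq kC.
Qed.

Lemma palette_extraction (R : realType) (eps : R) (n : nat) : 0 < eps -> (2 < n)%N ->
  exists (K N : nat), (1 < N)%N /\
    forall (V : finType) (p : V -> 'I_N * 'I_N) (E : {set {set V}}),
    partitioned_hypergraph p E -> density_at_least p E (4 / 27 + eps) ->
    exists (P : 'I_K -> 'I_K -> 'I_K -> bool) (S : seq 'I_N) (c : 'I_N -> 'I_N -> 'I_K -> V),
      [/\ increasing S, size S = n, colors_C5 P,
        (forall a (i j : 'I_N), i \in S -> j \in S -> (i < j)%N -> inpart p i j (c i j a)) &
        forall a b d (i j k : 'I_N), i \in S -> j \in S -> k \in S -> (i < j)%N -> (j < k)%N ->
          P a b d -> [set c i j a; c i k b; c j k d] \in E].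
Proof.
(* The K steps lose 10/K in total, which must stay below [eps]. *)
move=> d0 n2; pose K := Num.bound (10 / eps).
have Kd : 10 / eps < K%:R by apply: archi_boundP; rewrite divr_ge0 // ltW.
have Kp : 0 < K%:R :> R by apply: le_lt_trans Kd; rewrite divr_ge0 // ltW.
have K0 : (0 < K)%N by rewrite -(ltr0n R).
have [L HL] := ramsey {set 'I_K * 'I_K * 'I_K} 3 n.
have [M HM] := labels_iter R K0 L (leqnn K).
(* Two indices give a nonempty part and so a default vertex. *)
pose N := maxn M 2; exists K, N; split; first by rewrite leq_max orbT.
move=> V p E hH hD.
have [v0 _] : exists v0 : V, True.
  have N1 : (1 < N)%N by rewrite leq_max orbT.
  have [_ h _] := hH; have [v _] := h (Ordinal (ltnW N1)) (Ordinal N1) isT.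
  by exists v.
have inc : increasing (enum 'I_N).
  by have := iota_ltn_sorted 0 N; rewrite -val_enum_ord sorted_map.
have [|||S1 [c1 [S1E sS1 pos dens]]] := HM N V v0 (fun i j x => uniform R p i j x)
  (fun x y z => edge E x y z) (4 / 27 + eps)
  (enum 'I_N) inc.
- by rewrite size_enum_ord leq_maxl.
- by move=> i j ij; apply: (uniform_prob R hH ij).
- move=> i j k _ _ _ ij jk; apply: le_trans (hD i j k ij jk) _.
  exact: triad_density_le.
have incS1 := increasing_subseq S1E inc.
pose pattern (i j k : 'I_N) : {set 'I_K * 'I_K * 'I_K} :=
  [set q : 'I_K * 'I_K * 'I_K | edge E (c1 i j q.1.1) (c1 i k q.1.2) (c1 j k q.2)].
pose chi t := if t is [:: i; j; k] then pattern i j k else set0.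
have [S [P0 [SS1 sS hom]]] := HL _ chi S1 (eq_leq (esym sS1)).
have incS := increasing_subseq SS1 incS1.
have patE (i j k : 'I_N) : i \in S -> j \in S -> k \in S -> (i < j)%N -> (j < k)%N ->
    pattern i j k = P0.
  by move=> iS jS kS ij jk; apply: (hom [:: i; j; k]) => //; apply: increasing_subseq3.
pose P a b d := (a, b, d) \in P0.
exists P, S, (fun i j a => c1 i j a); split=> //.
(* After K labels no uniform mass is left, so each triad of [S] has label density exceeding 4/27,
   against [palette_bound] at constant weight; n > 2 provides such a triad. *)
- apply: contrapT => noC5.
  have := palette_bound noC5 (w := fun=> 1 : R) (fun=> ler01).
  rewrite sumr_const card_ord => bound.
  have [i [j [k [iS jS kS ij jk]]]] : exists i j k, [/\ i \in S, j \in S, k \in S,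
      (i < j)%N & (j < k)%N].
    move: incS sS; case: (S) => [|i [|j [|k S']]]; try by move=> _ sn; rewrite -sn in n2.
    by rewrite /increasing /= => /and3P[ij jk _] _; exists i, j, k; rewrite !inE !eqxx !orbT.
  have sub := mem_subseq SS1.
  have := dens i j k (sub i iS) (sub j jS) (sub k kS) ij jk.
  have mixE (i' j' : 'I_N) : mix K (uniform R p i' j') (c1 i' j') K K =1
      (fun x => K%:R^-1 * \sum_(al < K) delta R (c1 i' j' al) x).
    by move=> x; rewrite /mix divff ?gt_eqF // subrr mul0r add0r.
  rewrite (eq_tri _ (mixE i j) (mixE i k) (mixE j k)) tri_labels.
  have -> : weight (fun a b d : 'I_K => edge E (c1 i j a) (c1 i k b) (c1 j k d)) (fun=> 1 : R) =
      weight P (fun=> 1).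
    do 3 (apply: eq_bigr => ? _); congr (_%:R * _); rewrite /P -(patE i j k) // inE //.
  set W := weight _ _ in bound *.
  move=> h.
  have : K%:R^-1 ^+ 3 * W <= K%:R^-1 ^+ 3 * (4 / 27 * K%:R ^+ 3).
    by rewrite ler_wpM2l // exprn_ge0 // invr_ge0 ltW.
  have -> : K%:R^-1 ^+ 3 * (4 / 27 * K%:R ^+ 3) = 4 / 27 :> R by field; rewrite gt_eqF.
  have : 10 * K%:R * K%:R^-1 ^+ 2 < eps.
    have -> : 10 * K%:R * K%:R^-1 ^+ 2 = 10 / K%:R :> R by field; rewrite gt_eqF.
    by rewrite ltr_pdivrMr // mulrC -ltr_pdivrMr.
  move: h; move: (_ ^+ 3 * _) (_ * _ ^+ 2) => x y; clear; lra.
- move=> a i j iS jS ij.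
  have := pos a i j (ltn_ord a) (mem_subseq SS1 iS) (mem_subseq SS1 jS) ij.
  by rewrite /uniform; case: inpart => //; rewrite mul0r ltxx.
- move=> a b d i j k iS jS kS ij jk.
  by rewrite /P -(patE i j k) // inE.
Qed.

Local Close Scope ring_scope.

(** * Embedding the cycle *)

Section Symmetry.
Variables (A : Type) (P : A -> A -> A -> bool) (I : eqType) (rk : I -> nat) (col : I -> I -> A).
Hypothesis colC : forall i j, col i j = col j i.

Definition compatible (i j k : I) : bool :=
  sorted_triple P (rk i) (rk j) (rk k) (col i j) (col i k) (col j k).

Lemma compatibleC12 i j k : rk i != rk j -> compatible i j k -> compatible j i k.
Proof.
rewrite /compatible /sorted_triple (colC j i).
by do ![case: ltnP => ? //] => //; lia.
Qed.

Lemma compatibleC23 i j k : rk j != rk k -> compatible i j k -> compatible i k j.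
Proof.
rewrite /compatible /sorted_triple (colC k j).
by do ![case: ltnP => ? //] => //; lia.
Qed.

(** For symmetric colours and distinct ranks, compatibility depends only on the set of three
    vertices. *)
Lemma compatible_perm i j k i' j' k' : uniq [:: rk i; rk j; rk k] ->
  i' \in [:: i; j; k] -> j' \in [:: i; j; k] -> k' \in [:: i; j; k] ->
  uniq [:: i'; j'; k'] -> compatible i j k -> compatible i' j' k'.
Proof.
rewrite /= !inE !andbT !negb_or => /andP[/andP[ij ik] jk] hi hj hk /andP[/andP[ij' ik'] jk'].
have ji : rk j != rk i by rewrite eq_sym.
have ki : rk k != rk i by rewrite eq_sym.
have kj : rk k != rk j by rewrite eq_sym.
move=> c.
have c1 := compatibleC12 ij c; have c2 := compatibleC23 jk c.
have c3 := compatibleC23 ik c1; have c4 := compatibleC12 ik c2.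
have c5 := compatibleC12 jk c3.
by case/or3P: hi hj hk ij' ik' jk' => /eqP -> /or3P[] /eqP -> /or3P[] /eqP ->; rewrite ?eqxx.
Qed.
End Symmetry.

Section FoldCycle.
Variable m : nat.
Local Notation l := (3 * m + 2).

(* The homomorphism from C_{3m+2} to C_5: turn m-1 times around 0, 1, 2, then walk through
   0, 1, 2, 3, 4. *)
Definition fold5 (i : 'I_l) : 'I_5 :=
  inord (if i < 3 * m.-1 then i %% 3 else i - 3 * m.-1).

Lemma fold5E (i : 'I_l) : fold5 i = (if i < 3 * m.-1 then i %% 3 else i - 3 * m.-1) :> nat.
Proof.
rewrite inordK //; case: ifP => _; first exact: leq_trans (ltn_pmod _ _) _.
by have := ltn_ord i; lia.
Qed.

(** Inside the laps the images run cyclically through 0, 1, 2, which is an edge of C_5; the last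
    five vertices start again at 0 and close up as in C_5. *)
Lemma fold5_consecutive (q : 'I_l) : 0 < m ->
  let q1 := addmod q 1 in let q2 := addmod q 2 in
  [\/ fold5 q1 = addmod (fold5 q) 1 /\ fold5 q2 = addmod (fold5 q) 2,
      [/\ fold5 q = 1 :> nat, fold5 q1 = 2 :> nat & fold5 q2 = 0 :> nat] |
      [/\ fold5 q = 2 :> nat, fold5 q1 = 0 :> nat & fold5 q2 = 1 :> nat]].
Proof.
move=> m0 q1 q2.
have ql := ltn_ord q.
have E1 : val q1 = if q.+1 < l then q.+1 else 0.
  rewrite /q1 /= addn1; case: ltnP => h; first by rewrite modn_small.
  by rewrite (_ : q.+1 = l) ?modnn //; apply/eqP; rewrite eqn_leq h andbT.
have E2 : val q2 = if q.+2 < l then q.+2 else q.+2 - l.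
  rewrite /q2 /= addn2; case: ltnP => h; first by rewrite modn_small.
  rewrite -{1}(subnK h) modnDr modn_small //.
  by move: (nat_of_ord q) ql h; clear => x; lia.
have F := fold5E q; have F1 := fold5E q1; have F2 := fold5E q2.
rewrite E1 in F1; rewrite E2 in F2.
have key : [\/ (fold5 q1 = (fold5 q + 1) %% 5 :> nat) /\ (fold5 q2 = (fold5 q + 2) %% 5 :> nat),
      [/\ fold5 q = 1 :> nat, fold5 q1 = 2 :> nat & fold5 q2 = 0 :> nat] |
      [/\ fold5 q = 2 :> nat, fold5 q1 = 0 :> nat & fold5 q2 = 1 :> nat]].
  rewrite F F1 F2; move: (nat_of_ord q) ql; clear -m0 => x.
  have -> : m = m.-1.+1 by lia.
  move: m.-1 => k /=; clear => hx.
  have [h1|h1] := ltnP x.+1 (3 * k.+1 + 2); have [h2|h2] := ltnP x.+2 (3 * k.+1 + 2);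
    try lia.
  - have [h3|h3] := ltnP x (3 * k); have [h4|h4] := ltnP x.+1 (3 * k);
      have [h5|h5] := ltnP x.+2 (3 * k); try lia.
    + have : x %% 3 < 3 by rewrite ltn_pmod.
      case e: (x %% 3) => [|[|[|//]]] _; [constructor 1|constructor 2|constructor 3]; split; lia.
    + by constructor 2; split; lia.
    + by constructor 3; split; lia.
    + by constructor 1; split; lia.
  - by constructor 1; case: ifP; case: ifP; case: ifP; lia.
  - by constructor 1; case: ifP; case: ifP; case: ifP; lia.
case: key => [[k1 k2]|k|k]; [constructor 1 | constructor 2; exact: k | constructor 3; exact: k].
by split; apply: val_inj.
Qed.
End FoldCycle.

Definition pair_color (A : Type) (e z : 'I_5 -> A) (x y : 'I_5) : A :=
  if y == addmod x 1 then e x else if x == addmod y 1 then e y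
  else if y == addmod x 2 then z x else z y.

Lemma pair_colorC A (e z : 'I_5 -> A) x y : pair_color e z x y = pair_color e z y x.
Proof.
rewrite /pair_color; have [->//|xy] := eqVneq x y.
by case: x xy => [[|[|[|[|[|]]]]] xlt] // xy; case: y xy => [[|[|[|[|[|]]]]] ylt].
Qed.

Lemma pair_color_compatible A (P : A -> A -> A -> bool) (r : 'I_5 -> 'I_5) e z (s : 'I_5) :
  sorted_triple P (r s) (r (addmod s 1)) (r (addmod s 2)) (e s) (z s) (e (addmod s 1)) ->
  compatible P r (pair_color e z) s (addmod s 1) (addmod s 2).
Proof.
rewrite /compatible; have -> : pair_color e z s (addmod s 1) = e s.
  by rewrite /pair_color eqxx.
have -> : pair_color e z s (addmod s 2) = z s.
  by rewrite /pair_color; case: s => [[|[|[|[|[|]]]]] slt].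
suff -> : pair_color e z (addmod s 1) (addmod s 2) = e (addmod s 1) by [].
have -> : addmod s 2 = addmod (addmod s 1) 1 by case: s => [[|[|[|[|[|]]]]] slt] //; apply: val_inj.
by rewrite /pair_color eqxx.
Qed.

Lemma colors_tight_cycle (A : Type) (P : A -> A -> A -> bool) (m : nat) : 0 < m -> colors_C5 P ->
  exists (rk : 'I_(3 * m + 2) -> nat) (col : 'I_(3 * m + 2) -> 'I_(3 * m + 2) -> A),
  [/\ injective rk, forall i, rk i < 5 * (3 * m + 2), forall i j, col i j = col j i &
    forall q, uniq [:: q; addmod q 1; addmod q 2] /\
      compatible P rk col q (addmod q 1) (addmod q 2)].
Proof.
move=> m0 [r [e [z [ri H]]]]; set l := 3 * m + 2.
(* Lexicographic ranks, by image first and by index second: they are injective and, on the three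
   distinct images of an edge, agree with the order [r]. *)
pose h := @fold5 m; pose rk (i : 'I_l) := r (h i) * l + i.
pose col i j := pair_color e z (h i) (h j); exists rk, col.
have rkE i j : r (h i) != r (h j) -> (rk i < rk j) = (r (h i) < r (h j)).
  move=> ne; have := ltn_ord i; have := ltn_ord j; rewrite -/l /rk => jl il.
  have [rij|rij] := ltnP (r (h i)) (r (h j)).
    by have := leq_mul2r l (r (h i)).+1 (r (h j)); rewrite rij orbT mulSn; lia.
  have {}rij : r (h j) < r (h i) by rewrite ltn_neqAle rij andbT eq_sym.
  by have := leq_mul2r l (r (h j)).+1 (r (h i)); rewrite rij orbT mulSn; lia.
have l0 : 0 < l by rewrite /l addn2.
split.
- move=> i j /(congr1 (fun x => x %% l)); rewrite /rk !modnMDl !modn_small // => ij.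
  exact: val_inj.
- move=> i; rewrite /rk; have := leq_mul2r l (r (h i)).+1 5; rewrite ltn_ord orbT mulSn => k.
  by apply: leq_trans k; rewrite addnC ltn_add2r.
- by move=> i j; apply: pair_colorC.
move=> q; set q1 := addmod q 1; set q2 := addmod q 2.
have C s := pair_color_compatible (H s).
have [hU hC] : uniq [:: h q; h q1; h q2] /\ compatible P r (pair_color e z) (h q) (h q1) (h q2).
  have U5 (s : 'I_5) : uniq [:: s; addmod s 1; addmod s 2].
    by case: s => [[|[|[|[|[|]]]]] slt].
  have perm a b c : a \in [:: 0; 1; 2] -> b \in [:: 0; 1; 2] -> c \in [:: 0; 1; 2] ->
      uniq [:: a; b; c] -> h q = a :> nat -> h q1 = b :> nat -> h q2 = c :> nat ->
      uniq [:: h q; h q1; h q2] /\ compatible P r (pair_color e z) (h q) (h q1) (h q2).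
    move=> ha hb hc U ea eb ec.
    have U' : uniq [:: h q; h q1; h q2].
      by rewrite -(map_inj_uniq val_inj) /= ea eb ec.
    split=> //; apply: (compatible_perm (@pair_colorC _ e z) _ _ _ _ U' (C ord0)).
    + by have := U5 ord0; rewrite -(map_inj_uniq ri) -(map_inj_uniq val_inj).
    + by rewrite -(mem_map val_inj) /= ea; case/or4P: ha => // /eqP ->.
    + by rewrite -(mem_map val_inj) /= eb; case/or4P: hb => // /eqP ->.
    + by rewrite -(mem_map val_inj) /= ec; case/or4P: hc => // /eqP ->.
  have := fold5_consecutive q m0; rewrite -/q1 -/q2 -/h /=.
  case=> [[e1 e2]|[ea eb ec]|[ea eb ec]].
  - by rewrite e1 e2; split; [apply: U5 | apply: C].
  - exact: perm ea eb ec.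
  - exact: perm ea eb ec.
have rU : uniq [:: r (h q); r (h q1); r (h q2)] by rewrite -(map_inj_uniq ri) in hU.
split; first by apply: (@map_uniq _ _ h).
move: hC; rewrite /compatible /sorted_triple -/(col q q1) -/(col q q2) -/(col q1 q2).
by move: rU; rewrite /= !inE negb_or andbT => /andP[/andP[n1 n2] n3]; rewrite !rkE.
Qed.

Theorem theorem7p3 (R : realType) (m : nat) :
  forall delta : R, (0 < delta)%R ->
  exists N : nat,
    forall (V : finType) (p : V -> 'I_N * 'I_N) (E : {set {set V}}),
      partitioned_hypergraph p E ->
      density_at_least p E (4 / 27 + delta)%R ->
      embeds p E (tight_cycle (3 * m + 2)).
Proof.
move=> delta d0; set l := 3 * m + 2.
(* Ranks lie below 5l, so [S] receives one entry for each possible rank. *)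
have n2 : 2 < 5 * l by rewrite /l; lia.
have [K [N [N1 HN]]] := palette_extraction d0 n2.
exists N => V p E hH hD.
have [P [S [c [incS sS C5 cp cE]]]] := HN V p E hH hD.
have [rk [col [rki rkl colC comp]]] : exists (rk : 'I_l -> nat) (col : 'I_l -> 'I_l -> 'I_K),
  [/\ injective rk, forall i, rk i < 5 * l, forall i j, col i j = col j i &
    forall q, 0 < m -> uniq [:: q; addmod q 1; addmod q 2] /\
      compatible P rk col q (addmod q 1) (addmod q 2)].
  (* For m = 0 there are two vertices and no triple i < j < k, so a constant colouring serves. *)
  have [m0|m0] := posnP m.
    have [_ [e _]] := C5; exists val, (fun _ _ => e ord0); split=> //.
    - exact: val_inj.
    - by move=> i; apply: leq_trans (ltn_ord i) _; rewrite leq_pmull.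
  have [rk [col [h1 h2 h3 h4]]] := colors_tight_cycle m0 C5.
  by exists rk, col; split=> // q _; apply: h4.
pose s0 := Ordinal (ltnW N1).
pose a i := nth s0 S (rk i).
have aS i : a i \in S by rewrite mem_nth // sS.
have a_lt (i j : 'I_l) : rk i < rk j -> a i < a j.
  move=> ij; apply: (sorted_ltn_nth (leT := fun x y : 'I_N => x < y) _ _ incS) => //.
  - by move=> y x z'; apply: ltn_trans.
  - by rewrite inE sS.
  - by rewrite inE sS.
(* Labels are indexed by increasing pairs, so the two indices are sorted by rank first. *)
exists a, (fun i j => if rk i < rk j then c (a i) (a j) (col i j) else c (a j) (a i) (col i j)).
have rk_neq (i j : 'I_l) : i < j -> rk i != rk j.
  by move=> ij; apply: contraTneq ij => /rki ->; rewrite ltnn.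
split; [|split].
- move=> i j /eqP; rewrite nth_uniq ?sS // ?increasing_uniq // => /eqP; exact: rki.
- move=> i j ij; case: ifP => rij; first by apply: cp => //; apply: a_lt.
  rewrite /inpart orbC; apply: cp => //; apply: a_lt.
  by rewrite ltn_neqAle eq_sym rk_neq // leqNgt rij.
move=> i j k ij jk /imsetP[q _ sq]; have ik := ltn_trans ij jk.
have m0 : 0 < m.
  have: 2 < l by apply: leq_ltn_trans (ltn_ord k); apply: leq_ltn_trans jk;
    apply: leq_ltn_trans (leq0n i) ij.
  by rewrite /l -{1}[2]add0n ltn_add2r muln_gt0.
have [qU qC] := comp q m0.
have mem x : x \in [set i; j; k] -> x \in [:: q; addmod q 1; addmod q 2].
  by rewrite sq !inE -orbA.
have C : compatible P rk col i j k.
  apply: (compatible_perm colC _ _ _ _ _ qC).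
  - by rewrite -(map_inj_uniq rki) in qU.
  - by apply: mem; rewrite !inE eqxx.
  - by apply: mem; rewrite !inE eqxx orbT.
  - by apply: mem; rewrite !inE eqxx !orbT.
  - by rewrite /= !inE negb_or -!(inj_eq val_inj) /= !ltn_eqF.
have := rk_neq _ _ ij; have := rk_neq _ _ jk; have := rk_neq _ _ ik.
move: C; rewrite /compatible /sorted_triple.
have sE (X Y : {set V}) : X = Y -> X \in E -> Y \in E by move=> ->.
have {}cE b1 b2 b3 (i1 i2 i3 : 'I_l) : rk i1 < rk i2 -> rk i2 < rk i3 -> P b1 b2 b3 ->
    [set c (a i1) (a i2) b1; c (a i1) (a i3) b2; c (a i2) (a i3) b3] \in E.
  by move=> h1 h2; apply: cE => //; apply: a_lt.
clear -cE sE.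
(* Each of the six possible orders of the ranks lists the same three vertices in another order. *)
have [lij|lij] := ltnP (rk i) (rk j); have [ljk|ljk] := ltnP (rk j) (rk k);
  have [lik|lik] := ltnP (rk i) (rk k) => PC nik njk nij; try (exfalso; lia).
- exact: cE PC.
- apply: sE (cE _ _ _ i k j _ _ PC) => //; last by rewrite ltn_neqAle eq_sym njk.
  by apply/setP => w; rewrite !inE; do 3!case: (w == _).
- apply: sE (cE _ _ _ k i j _ _ PC) => //; last by rewrite ltn_neqAle eq_sym nik.
  by apply/setP => w; rewrite !inE; do 3!case: (w == _).
- apply: sE (cE _ _ _ j i k _ _ PC) => //; last by rewrite ltn_neqAle eq_sym nij.
  by apply/setP => w; rewrite !inE; do 3!case: (w == _).
- apply: sE (cE _ _ _ j k i _ _ PC) => //; last by rewrite ltn_neqAle eq_sym nik.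
  by apply/setP => w; rewrite !inE; do 3!case: (w == _).
- apply: sE (cE _ _ _ k j i _ _ PC); last 2 first.
  + by rewrite ltn_neqAle eq_sym njk.
  + by rewrite ltn_neqAle eq_sym nij.
  by apply/setP => w; rewrite !inE; do 3!case: (w == _).
Qed.
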